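(* Let $l,m\geq 1$ be integers and let $\epsilon$ be the sequence of length $2ml$ consisting of $2m$ consecutive blocks of length $l$, where the first block consists of $+1$'s, the second of $-1$'s, the third of $+1$'s, and so on alternately (so the last block consists of $-1$'s). Then the number of pairs $(\sigma,<)$, where $\sigma$ is a non-crossing pairing of $\{1,\dots,2ml\}$ compatible with $\epsilon$ and $<$ is a total order on the vertices of the quotient tree $T_\sigma$ which is compatible with the orientations of the edges, is exactly $m^{ml}$.
   Context: For $\epsilon=(\epsilon(1),\dots,\epsilon(k))\in\{-1,+1\}^k$, let $G_\epsilon$ be the oriented $k$-gon with vertices $v_1,\dots,v_k$ and edges $e_1,\dots,e_k$, where $e_i$ joins $v_i$ and $v_{i+1}$ (with $v_{k+1}:=v_1$); $e_i$ is oriented from $v_{i+1}$ to $v_i$ if $\epsilon(i)=+1$ and from $v_i$ to $v_{i+1}$ if $\epsilon(i)=-1$. A pairing $\sigma$ of $\{1,\dots,k\}$ is a partition into 2-element blocks; it is compatible with $\epsilon$ if $\epsilon(i)+\epsilon(j)=0$ for every $\{i,j\}\in\sigma$, and it is non-crossing if there are no $p<q<r<s$ with $\{p,r\},\{q,s\}\in\sigma$. The quotient graph $T_\sigma$ is obtained from $G_\epsilon$ by gluing, for each $\{i,j\}\in\sigma$, the edge $e_i$ to the edge $e_j$ so that $v_i$ is identified with $v_{j+1}$ and $v_{i+1}$ with $v_j$ (vertices are identified according to the equivalence relation generated by these identifications); each edge of $T_\sigma$ inherits the common orientation of the two edges of $G_\epsilon$ it comes from. For non-crossing $\sigma$, $T_\sigma$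 is a tree. For vertices $x,y$ of $T_\sigma$ write $x\prec y$ if there is a nonempty directed path from $y$ to $x$ travelling along edges in the direction of their arrows. A total order $<$ on the vertices of $T_\sigma$ is compatible with the orientations of the edges if $x\prec y$ implies $x<y$. *)

(* Defs.v *)
From mathcomp Require Import all_boot all_order all_algebra.

Set Implicit Arguments.
Unset Strict Implicit.
Unset Printing Implicit Defensive.

Import GRing.Theory.
Local Open Scope ring_scope.

(* Indices are shifted by one: i : 'I_k stands both for the vertex v_(i+1) and
   for the edge e_(i+1) of the polygon, and ordS is the cyclic successor, so
   that the edge i joins the vertices i and ordS i. *)

Definition edge_source k (eps : 'I_k -> int) (i : 'I_k) : 'I_k :=
  if eps i == 1 then ordS i else i.

Definition edge_target k (eps : 'I_k -> int) (i : 'I_k) : 'I_k :=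
  if eps i == 1 then i else ordS i.

Definition pairing k (sigma : {set {set 'I_k}}) : bool :=
  partition sigma [set: 'I_k] && [forall b in sigma, #|b| == 2].

Definition pairing_compatible k (eps : 'I_k -> int) (sigma : {set {set 'I_k}})
    : bool :=
  [forall i, forall j, ([set i; j] \in sigma) ==> (eps i + eps j == 0)].

Definition noncrossing k (sigma : {set {set 'I_k}}) : bool :=
  ~~ [exists p : 'I_k, exists q : 'I_k, exists r : 'I_k, exists s : 'I_k,
       [&& (p < q)%N, (q < r)%N, (r < s)%N,
           [set p; r] \in sigma & [set q; s] \in sigma]].

(* Since [set i; j] = [set j; i], both identifications (the vertex i with
   ordS j, and ordS i with j) are covered; the second disjunct makes the
   relation symmetric, so that connect (glue sigma) is an equivalence. *)
Definition glue k (sigma : {set {set 'I_k}}) : rel 'I_k := fun x y =>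
  [exists i, exists j, ([set i; j] \in sigma) &&
     ((x == i) && (y == ordS j) || (x == ordS j) && (y == i))].

Definition qvertex k (sigma : {set {set 'I_k}}) (v : 'I_k) : {set 'I_k} :=
  [set w | connect (glue sigma) v w].

Definition qvertices k (sigma : {set {set 'I_k}}) : {set {set 'I_k}} :=
  [set qvertex sigma v | v : 'I_k].

(* When sigma is compatible with eps, two glued edges have the same source and
   the same target in the quotient, so each edge of the quotient gives one
   arrow. *)
Definition qarrow k (eps : 'I_k -> int) (sigma : {set {set 'I_k}})
    : rel {set 'I_k} := fun x y =>
  [exists i, (x == qvertex sigma (edge_source eps i)) &&
             (y == qvertex sigma (edge_target eps i))].

(* The first step y -> z is explicit, so the path from y to x is nonempty. *)
Definition qprec k (eps : 'I_k -> int) (sigma : {set {set 'I_k}})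
    : rel {set 'I_k} := fun x y =>
  [exists z, qarrow eps sigma y z && connect (qarrow eps sigma) z x].

(* A relation is given by its graph lt, where (x, y) \in lt means x < y; the
   inclusion in V x V makes lt unique for a given order on V. *)
Definition strict_total_order (T : finType) (V : {set T}) (lt : {set T * T})
    : bool :=
  [&& lt \subset setX V V,
      [forall x in V, (x, x) \notin lt],
      [forall x in V, forall y in V, forall z in V,
         ((x, y) \in lt) ==> ((y, z) \in lt) ==> ((x, z) \in lt)]
    & [forall x in V, forall y in V,
         (x != y) ==> ((x, y) \in lt) || ((y, x) \in lt)]].

Definition order_compatible k (eps : 'I_k -> int) (sigma : {set {set 'I_k}})
    (lt : {set {set 'I_k} * {set 'I_k}}) : bool :=
  [forall x in qvertices sigma, forall y in qvertices sigma,
     qprec eps sigma x y ==> ((x, y) \in lt)].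

Definition ordered_quotient_trees k (eps : 'I_k -> int)
    : {set {set {set 'I_k}} * {set {set 'I_k} * {set 'I_k}}} :=
  [set u | [&& pairing u.1, noncrossing u.1, pairing_compatible eps u.1,
               strict_total_order (qvertices u.1) u.2
             & order_compatible eps u.1 u.2]].

Definition block_signs (l m : nat) (i : 'I_(2 * m * l)) : int :=
  (-1) ^+ (i %/ l)%N.

(* Main.v *)
Require Import Defs.
From mathcomp Require Import all_boot all_order all_algebra.
From HB Require Import structures.
From mathcomp Require Import perm ring zify.

(* Proof idea. Write [n] for [m * l].  Give the vertices of a tree independent
   uniform labels in [[0, 1]]: the number of compatible orders is [(n + 1)!]
   times the integral over [x] of the volume of the compatible labelings whose
   root has label [x].  Summed over all trees with a given contour word, these
   volumes are polynomials in [x], defined by cutting the word at the return to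
   the root of its first edge.

   Let [F_m] be the polynomial of the word (+^l -^l)^m.  Each derivation of
   [F_m] marks one more pair of letters: up to sign, the [j]-th derivative is a
   sum over Dyck words of [2 j] marked letters of products of volumes of the
   unmarked factors, because a path has one peak more than it has valleys.
   With weight [a] on each marked ascending letter, the sum [K_m] of all these
   terms satisfies [a * K_m' = F_m - K_m].  At [x = 1] unmarked factors can
   only leave downwards, at [x = 0] only upwards; reflecting the labels gives
   [K_m(1) = a ^ l * K_(m-1)(0)], that is,
   [F_m^(l)(x) = (-1)^l F_(m-1)(x - 1)], where [F_m] vanishes to order [l] at
   [1] when [m > 0].

   Hence [(n + 1)!] times the integral of [F_m] counts the functions from
   [n + 1] points to [m] boxes such that, for every [0 < i <= m], the first [i]
   boxes contain more than [l * i] points.  By the cycle lemma, exactly one of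
   the [m] rotations of any function has this property, which leaves
   [m ^ (n + 1) / m] functions. *)

Set Implicit Arguments.
Unset Strict Implicit.
Unset Printing Implicit Defensive.

Import Order.TTheory GRing.Theory Num.Theory.
Local Open Scope ring_scope.

(** * Splitting words *)

Section Words.
Implicit Types (b c : bool) (u v w : seq bool).

Fixpoint splits b w : seq (seq bool * seq bool) :=
  if w is c :: w' then
    (if c == b then [:: ([::], w')] else [::]) ++
    [seq (c :: p.1, p.2) | p <- splits b w']
  else [::].

Lemma mem_splits b w p : (p \in splits b w) = (w == p.1 ++ b :: p.2).
Proof.
case: p => u v /=; elim: w u v => [|c w IH] u v /=; first by case: u.
rewrite mem_cat; case: u => [|d u].
  have /negPf-> : ([::], v) \notin [seq (c :: p.1, p.2) | p <- splits b w].
    by apply/mapP => -[].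
  rewrite orbF eqseq_cons; case: (c =P b) => //= _.
  by rewrite mem_seq1 xpair_eqE /= eq_sym.
rewrite cat_cons eqseq_cons.
have /negPf-> : (d :: u, v) \notin (if c == b then [:: ([::], w)] else [::]).
  by case: ifP; rewrite // mem_seq1.
apply/mapP/andP => [[[u' v'] + [-> -> ->]]|[/eqP-> e]].
  by rewrite IH eqxx.
by exists (u, v); rewrite // IH.
Qed.

Lemma splits_uniq b w : uniq (splits b w).
Proof.
elim: w => //= c w IH; rewrite cat_uniq map_inj_uniq ?IH; last first.
  by move=> [u v] [u' v'] [-> ->].
rewrite andbT; apply/andP; split; first by case: ifP.
by apply/hasPn => _ /mapP[p _ ->]; case: ifP.
Qed.

Definition spl (V : nmodType) b w (f : seq bool -> seq bool -> V) : V :=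
  \sum_(p <- splits b w) f p.1 p.2.

Lemma spl_nil (V : nmodType) b (f : seq bool -> seq bool -> V) :
  spl b [::] f = 0.
Proof. exact: big_nil. Qed.

Lemma spl_cons (V : nmodType) b c w (f : seq bool -> seq bool -> V) :
  spl b (c :: w) f =
  (if c == b then f [::] w else 0) + spl b w (fun u v => f (c :: u) v).
Proof.
rewrite /spl big_cat big_map; congr (_ + _).
by case: ifP; rewrite ?big_seq1 ?big_nil.
Qed.

Lemma eq_spl (V : nmodType) b w (f g : seq bool -> seq bool -> V) :
  (forall u v, w = u ++ b :: v -> f u v = g u v) -> spl b w f = spl b w g.
Proof.
move=> fg; apply: eq_big_seq => -[u v].
by rewrite mem_splits => /eqP; apply: fg.
Qed.

Lemma spl0 (V : nmodType) b w (f : seq bool -> seq bool -> V) :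
  (forall u v, w = u ++ b :: v -> f u v = 0) -> spl b w f = 0.
Proof. by move/eq_spl->; apply: big1. Qed.

Lemma splD (V : nmodType) b w (f g : seq bool -> seq bool -> V) :
  spl b w (fun u v => f u v + g u v) = spl b w f + spl b w g.
Proof. exact: big_split. Qed.

Lemma spl_mulr (R : pzRingType) b w (a : R) f :
  a * spl b w f = spl b w (fun u v => a * f u v).
Proof. exact: big_distrr. Qed.

(** Both sides sum over all ways to write [w = u ++ b1 :: x ++ b2 :: v]; the two cuts can be chosen
    in either order. *)
Lemma spl_assoc (V : nmodType) b1 b2 w (g : seq bool -> seq bool -> seq bool -> V) :
  spl b1 w (fun u v => spl b2 v (g u)) =
  spl b2 w (fun u v => spl b1 u (fun u1 u2 => g u1 u2 v)).
Proof.
elim: w g => [|c w IH] g; first by rewrite !spl_nil.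
rewrite !spl_cons IH !spl_nil if_same add0r.
under [RHS]eq_spl => u v _ do rewrite spl_cons.
rewrite splD; congr (_ + _); case: ifP => // _.
by rewrite spl0.
Qed.

Lemma spl_cat_nomem (V : nmodType) b w x (f : seq bool -> seq bool -> V) :
  b \notin x -> spl b (w ++ x) f = spl b w (fun u v => f u (v ++ x)).
Proof.
move=> bx; elim: w f => [|c w IH] f /=.
  rewrite spl_nil spl0 // => u v xE.
  by rewrite xE mem_cat mem_head orbT in bx.
by rewrite !spl_cons IH.
Qed.

Lemma spl_negb (V : nmodType) b w (f : seq bool -> seq bool -> V) :
  spl b (map negb w) f = spl (~~ b) w (fun u v => f (map negb u) (map negb v)).
Proof.
elim: w f => [|c w IH] f /=; rewrite ?spl_nil // !spl_cons IH.
by rewrite (can2_eq negbK negbK).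
Qed.

(* [wsum mk ex w] sums over all ways to cut [w] into marked letters [b], of
   weight [mk b], and factors [b :: rcons u (~~ b)], of weight [ex b u]. *)
Section WeightedSum.
Variables (R : comPzRingType).
Implicit Types (mk : bool -> R) (ex : bool -> seq bool -> R).

Fixpoint wsum_rec mk ex n w : R :=
  if n is n'.+1 then
    if w is b :: w' then
      mk b * wsum_rec mk ex n' w' +
      spl (~~ b) w' (fun u v => ex b u * wsum_rec mk ex n' v)
    else 1
  else 1.

Definition wsum mk ex w := wsum_rec mk ex (size w) w.

Lemma wsum_nil mk ex : wsum mk ex [::] = 1.
Proof. by []. Qed.

(** The number [n] is only fuel: every recursive call is on a strictly shorter word. *)
Lemma wsum_recE mk ex n w :
  (size w <= n)%N -> wsum_rec mk ex n w = wsum mk ex w.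
Proof.
have [k] := ubnP n; rewrite /wsum; elim: k n w => // k IH [|n] [|b w] //= nk sw.
rewrite IH; [|lia|lia]; congr (_ + _); apply: eq_spl => u v wE.
move: sw; rewrite wE size_cat /= => sw.
rewrite IH; [|lia|lia]; rewrite [in RHS]IH //; [|lia].
by move: nk; rewrite !ltnS; lia.
Qed.

Lemma wsum_cons mk ex b w :
  wsum mk ex (b :: w) =
  mk b * wsum mk ex w + spl (~~ b) w (fun u v => ex b u * wsum mk ex v).
Proof.
rewrite {1}/wsum /=; congr (_ + _); apply: eq_spl => u v wE.
by rewrite wsum_recE // wE size_cat /=; lia.
Qed.

Lemma word_ind (P : seq bool -> Prop) :
  P [::] ->
  (forall b w, P w ->
     (forall u v, w = u ++ ~~ b :: v -> P u /\ P v) -> P (b :: w)) ->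
  forall w, P w.
Proof.
move=> P0 PS w; have [n] := ubnP (size w).
elim: n w => // n IH [|b w] //= sw; apply: PS => [|u v wE]; first by apply: IH; lia.
by move: sw; rewrite wE size_cat /= => sw; split; apply: IH; lia.
Qed.

(* Cutting at the first marked letter. *)
Lemma wsum_first mk ex w :
  let free := wsum (fun=> 0) ex in
  wsum mk ex w =
  free w + spl true w (fun u v => free u * (mk true * wsum mk ex v))
         + spl false w (fun u v => free u * (mk false * wsum mk ex v)).
Proof.
move=> free.
have freeS b u : free (b :: u) = spl (~~ b) u (fun u v => ex b u * free v).
  by rewrite /free wsum_cons mul0r add0r.
elim/word_ind: w => [|b w _ IH]; first by rewrite !spl_nil !addr0.
(* A free word starting with [b] is cut at the letter closing its first factor. Exchanging this cut
   with the one at the marked letter lets the induction hypothesis act on the rest [v]. *)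
have key d : spl d w (fun u v => free (b :: u) * (mk d * wsum mk ex v)) =
    spl (~~ b) w (fun u v => ex b u *
       spl d v (fun u' v' => free u' * (mk d * wsum mk ex v'))).
  under [RHS]eq_spl => u v _ do rewrite spl_mulr.
  rewrite spl_assoc; apply: eq_spl => u v _.
  rewrite freeS mulrC spl_mulr; apply: eq_spl => u1 u2 _.
  by ring.
rewrite wsum_cons !spl_cons !key freeS.
under eq_spl => u v wE.
  by case: (IH _ _ wE) => _ ->; rewrite !mulrDr; over.
by rewrite !splD; case: b {key freeS IH} => /=; rewrite [free [::]]wsum_nil; ring.
Qed.

Lemma wsum_ext mk mk' ex ex' w :
  mk =1 mk' -> (forall b u, ex b u = ex' b u) -> wsum mk ex w = wsum mk' ex' w.
Proof.
move=> mkE exE; elim/word_ind: w => // b w IH1 IH2.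
rewrite !wsum_cons mkE IH1; congr (_ + _); apply: eq_spl => u v wE.
by case: (IH2 _ _ wE) => _ ->; rewrite exE.
Qed.

Lemma wsum_negb mk ex w :
  wsum mk ex (map negb w) = wsum (mk \o negb) (fun b u => ex (~~ b) (map negb u)) w.
Proof.
elim/word_ind: w => // b w IH1 IH2.
rewrite map_cons !wsum_cons IH1 spl_negb negbK /=; congr (_ + _); apply: eq_spl => u v wE.
by case: (IH2 _ _ wE) => _ ->.
Qed.

End WeightedSum.

Lemma rmorph_wsum (R S : comPzRingType) (h : {rmorphism R -> S}) mk ex w :
  h (wsum mk ex w) = wsum (h \o mk) (fun b u => h (ex b u)) w.
Proof.
elim/word_ind: w => [|b w IH1 IH2]; first by rewrite !wsum_nil rmorph1.
rewrite !wsum_cons rmorphD rmorphM IH1 /=; congr (_ + _).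
transitivity (spl (~~ b) w (fun u v => h (ex b u * wsum mk ex v))); first exact: rmorph_sum.
by apply: eq_spl => u v wE; case: (IH2 _ _ wE) => _ IHv; rewrite rmorphM IHv.
Qed.

End Words.

(** * Volume polynomials *)

(** The antiderivative vanishing at 0: the constant coefficient is a division by zero, hence 0. *)
Definition prim (p : {poly rat}) : {poly rat} :=
  \poly_(i < (size p).+1) (p`_i.-1 / i%:R).

Lemma coef_prim p i : (prim p)`_i = p`_i.-1 / i%:R.
Proof.
rewrite coef_poly; case: ltnP => // pi.
by rewrite nth_default ?mul0r //; case: i pi => //= i; rewrite ltnS.
Qed.

Fact prim_is_linear : linear prim.
Proof.
move=> a p q; apply/polyP => i.
by rewrite coefD coefZ !coef_prim coefD coefZ mulrDl mulrA.
Qed.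
HB.instance Definition _ :=
  GRing.isLinear.Build rat {poly rat} {poly rat} *:%R prim prim_is_linear.

Lemma deriv_prim p : (prim p)^`() = p.
Proof.
apply/polyP => i; rewrite coef_deriv coef_prim /= -[LHS]mulr_natr divfK //.
by rewrite pnatr_eq0.
Qed.

Lemma horner0_prim p : (prim p).[0] = 0.
Proof. by rewrite horner_coef0 coef_prim invr0 mulr0. Qed.

Lemma deriv_eq0 (p : {poly rat}) : p^`() = 0 -> p = (p.[0])%:P.
Proof.
move=> dp; apply/polyP => -[|i]; rewrite coefC /= ?horner_coef0 //.
have /eqP : p^`()`_i = 0 by rewrite dp coef0.
by rewrite coef_deriv mulrn_eq0 /= => /eqP.
Qed.

Lemma deriv_inj0 (p q : {poly rat}) a : p^`() = q^`() -> p.[a] = q.[a] -> p = q.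
Proof.
move=> dpq pqa; apply/eqP; rewrite -subr_eq0; apply/eqP.
have pqC : p - q = ((p - q).[0])%:P by apply: deriv_eq0; rewrite derivB dpq subrr.
by rewrite pqC; have := congr1 (fun p => p.[a]) pqC; rewrite !hornerE pqa subrr => <-.
Qed.

Definition unit_int (p : {poly rat}) : rat := (prim p).[1].

Fact unit_int_is_scalar : scalar unit_int.
Proof. by move=> a p q; rewrite /unit_int linearP hornerD hornerZ. Qed.
HB.instance Definition _ :=
  GRing.isLinear.Build rat {poly rat} rat *%R unit_int unit_int_is_scalar.

(* The integral of [p] over the labels allowed at the end of a step [b] from label ['X]. *)
Definition step_int b (p : {poly rat}) : {poly rat} :=
  if b then (unit_int p)%:P - prim p else prim p.
Arguments step_int : simpl never.

Fact step_int_is_linear b : linear (step_int b).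
Proof.
by move=> a p q; rewrite /step_int; case: b; rewrite !linearP //= polyCD polyCM -!mul_polyC; ring.
Qed.
HB.instance Definition _ b :=
  GRing.isLinear.Build rat {poly rat} {poly rat} *:%R (step_int b) (step_int_is_linear b).

Lemma deriv_step_int b p : (step_int b p)^`() = (-1) ^+ b * p.
Proof.
case: b; rewrite /step_int ?derivB ?derivC deriv_prim ?sub0r ?mul1r //.
by rewrite expr1 mulN1r.
Qed.

Lemma step_int0 b p : (step_int b p).[0] = if b then unit_int p else 0.
Proof. by case: b; rewrite /step_int ?hornerD ?hornerN ?hornerC horner0_prim ?subr0. Qed.

Lemma step_int1 b p : (step_int b p).[1] = if b then 0 else unit_int p.
Proof. by case: b; rewrite /step_int ?hornerD ?hornerN ?hornerC ?subrr. Qed.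

Definition reflect_poly (p : {poly rat}) : {poly rat} := p \Po (1 - 'X).

(** The substitution of [1 - x] for [x] exchanges the integrals over [[x, 1]] and [[0, x]]. It is
    checked on derivatives and on the value at 0, the latter by invariance of the full integral
    (fact [I]). *)
Lemma step_int_reflect b p :
  reflect_poly (step_int b p) = step_int (~~ b) (reflect_poly p).
Proof.
have D q : (reflect_poly q)^`() = - reflect_poly q^`().
  by rewrite /reflect_poly deriv_comp derivB derivX -polyC1 derivC sub0r mulrN1.
have E q a : (reflect_poly q).[a] = q.[1 - a].
  by rewrite /reflect_poly horner_comp !hornerE.
have I q : unit_int (reflect_poly q) = unit_int q.
  have pE : prim (reflect_poly q) = (unit_int q)%:P - reflect_poly (prim q).
    apply: (@deriv_inj0 _ _ 0); first by rewrite derivB derivC sub0r D opprK !deriv_prim.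
    by rewrite hornerD hornerN hornerC E subr0 subrr horner0_prim.
  by rewrite {1}/unit_int pE hornerD hornerN hornerC E subrr horner0_prim subr0.
apply: (@deriv_inj0 _ _ 0); last first.
  by rewrite E subr0 step_int1 step_int0 I; case: b.
rewrite D !deriv_step_int; case: b; rewrite ?expr1 ?expr0 ?mul1r ?mulN1r //.
by rewrite /reflect_poly rmorphN opprK.
Qed.

(** * Signed trees and their words *)

(* [Br b t1 t2] is the noncrossing pairing whose first block closes around [t1],
   the opening letter being [b]; it also encodes a plane tree whose root has a
   first child, above the root iff [b], carrying the subtree [t1]. *)
Inductive tree := Leaf | Br of bool & tree & tree.

Lemma tree_comparable : comparable tree.
Proof. rewrite /comparable /decidable; decide equality; exact: eq_comparable. Qed.
HB.instance Definition _ := hasDecEq.Build tree (compareP tree_comparable).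

Fixpoint word t : seq bool :=
  if t is Br b t1 t2 then b :: word t1 ++ ~~ b :: word t2 else [::].

Fixpoint edges t : nat := if t is Br _ t1 t2 then (edges t1 + edges t2).+1 else 0.

(** A polynomial in the root label. Once that label is fixed, the branches of the root are
    independent, and the first one is integrated over the label of its top vertex. *)
Fixpoint tree_vol t : {poly rat} :=
  if t is Br b t1 t2 then step_int b (tree_vol t1) * tree_vol t2 else 1.

Lemma size_word t : size (word t) = (edges t).*2.
Proof. by elim: t => //= b t1 IH1 t2 IH2; rewrite size_cat /= IH1 IH2; lia. Qed.

Lemma word_balanced t : count_mem true (word t) = count_mem false (word t).
Proof. by elim: t => //= -[] t1 IH1 t2 IH2; rewrite !count_cat /= IH1 IH2; lia. Qed.

Fixpoint trees_rec n w : seq tree :=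
  if n is n'.+1 then
    if w is b :: w' then
      flatten [seq [seq Br b t1 t2 | t1 <- trees_rec n' p.1, t2 <- trees_rec n' p.2]
              | p <- splits (~~ b) w']
    else [:: Leaf]
  else [:: Leaf].

Definition trees w := trees_rec (size w) w.

Lemma trees_recE n w : (size w <= n)%N -> trees_rec n w = trees w.
Proof.
have [k] := ubnP n; rewrite /trees; elim: k n w => // k IH [|n] [|b w] //= nk sw.
congr flatten; apply/eq_in_map => -[u v]; rewrite mem_splits /= => /eqP wE.
move: sw; rewrite wE size_cat /= => sw.
rewrite (IH n u) ?(IH n v); try lia.
by rewrite (IH _ u) ?(IH _ v) //; lia.
Qed.

Lemma trees_cons b w :
  trees (b :: w) =
  flatten [seq [seq Br b t1 t2 | t1 <- trees p.1, t2 <- trees p.2]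
          | p <- splits (~~ b) w].
Proof.
rewrite {1}/trees /=; congr flatten; apply/eq_in_map => -[u v].
rewrite mem_splits /= => /eqP wE.
by rewrite !trees_recE // wE size_cat /=; lia.
Qed.

Lemma mem_trees w t : (t \in trees w) = (word t == w).
Proof.
elim/word_ind: w t => [|b w _ IH] t.
  by case: t => [|b t1 t2]; rewrite mem_seq1 ?eqxx //; apply/eqP.
rewrite trees_cons; apply/flatten_mapP/eqP => [[[u v]]|].
  rewrite mem_splits /= => /eqP wE /allpairsP[[t1 t2] /= [+ + ->]] /=.
  by case: (IH _ _ wE) => -> -> /eqP e1 /eqP e2; rewrite wE e1 e2.
case: t => //= c t1 t2 [-> wE]; exists (word t1, word t2); first by rewrite mem_splits -wE.
case: (IH (word t1) (word t2)) => [|IH1 IH2]; first by rewrite -wE.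
by apply/allpairsP; exists (t1, t2); rewrite /= IH1 IH2.
Qed.

Lemma uniq_flatten_map (S : eqType) (T : eqType) (f : S -> seq T) (s : seq S) :
  uniq s -> {in s, forall x, uniq (f x)} ->
  (forall x y z, z \in f x -> z \in f y -> x = y) ->
  uniq (flatten (map f s)).
Proof.
move=> + + dis; elim: s => //= x s IH /andP[xs us] uf.
rewrite cat_uniq uf ?mem_head // IH //= => [|y ys]; last by rewrite uf // inE ys orbT.
rewrite andbT; apply/hasPn => z /flatten_mapP[y ys zy]; apply/negP => zx.
by rewrite (dis _ _ _ zx zy) ys in xs.
Qed.

Lemma trees_uniq w : uniq (trees w).
Proof.
elim/word_ind: w => // b w _ IH; rewrite trees_cons; apply: uniq_flatten_map.
- exact: splits_uniq.
- move=> [u v]; rewrite mem_splits => /eqP/IH[uu uv] /=.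
  by apply: allpairs_uniq => // -[t1 t2] [t1' t2'] _ _ [-> ->].
move=> [u v] [u' v'] z /allpairsP[[t1 t2] /= [+ + ->]] /allpairsP[[t1' t2'] /= [m1 m2 [e1 e2]]].
move: m1 m2; rewrite -{}e1 -{}e2 !mem_trees.
by move=> /eqP-> /eqP-> /eqP-> /eqP->.
Qed.

Definition vol w := \sum_(t <- trees w) tree_vol t.

Lemma vol_nil : vol [::] = 1.
Proof. by rewrite /vol big_seq1. Qed.

Lemma vol_cons b w :
  vol (b :: w) = spl (~~ b) w (fun u v => step_int b (vol u) * vol v).
Proof.
rewrite {1}/vol trees_cons big_flatten big_map; apply: eq_bigr => p _.
by rewrite big_allpairs_dep linear_sum big_distrlr.
Qed.

Lemma vol_unbalanced w : count_mem true w != count_mem false w -> vol w = 0.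
Proof.
move=> wu; rewrite /vol; case E: (trees w) => [|t s]; first by rewrite big_nil.
have : t \in trees w by rewrite E mem_head.
by rewrite mem_trees => /eqP tw; rewrite -tw word_balanced eqxx in wu.
Qed.

Lemma vol_wsum w : vol w = wsum (fun=> 0) (fun b u => step_int b (vol u)) w.
Proof.
elim/word_ind: w => [|b w _ IH]; first exact: vol_nil.
rewrite vol_cons wsum_cons mul0r add0r; apply: eq_spl => u v wE.
by case: (IH _ _ wE) => _ ->.
Qed.

Lemma vol_negb w : vol (map negb w) = reflect_poly (vol w).
Proof.
elim/word_ind: w => [|b w _ IH]; first by rewrite vol_nil /reflect_poly rmorph1.
rewrite map_cons !vol_cons spl_negb negbK /spl /reflect_poly rmorph_sum.
apply: eq_big_seq => -[u v]; rewrite mem_splits /= => /eqP wE.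
case: (IH _ _ wE) => -> ->; rewrite rmorphM; congr (_ * _).
by rewrite -[RHS]/(reflect_poly _) step_int_reflect.
Qed.

(** * Marked words *)

Definition marked a := wsum (fun b => if b then a%:P else 1)
                            (fun b u => step_int b (vol u)).

Lemma deriv_spl b w (f : seq bool -> seq bool -> {poly rat}) :
  (spl b w f)^`() = spl b w (fun u v => (f u v)^`()).
Proof. exact: (raddf_sum deriv). Qed.

(** By [wsum_first], the right-hand side collects the terms whose first marked letter ascends. In
    the induction on [b :: w], differentiating the leading factor removes its integral with sign
    [(-1) ^+ b] and leaves a sum over the cuts of [w] at [~~ b]. If [b] descends, this sum cancels
    the derivative of the term where [b] is marked. If [b] ascends, the two combine into
    [marked a w], because [vol w = 0]. *)
Lemma deriv_marked a w :
  (forall u v, w = u ++ true :: v -> vol v = 0) ->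
  - (a%:P * (marked a w)^`()) =
  spl true w (fun u v => vol u * (a%:P * marked a v)).
Proof.
elim/word_ind: w => [|b w IHw IH] suf.
  by rewrite spl_nil /marked wsum_nil -polyC1 derivC mulr0 oppr0.
have {}IHw : - (a%:P * (marked a w)^`()) = spl true w (fun u v => vol u * (a%:P * marked a v)).
  by apply: IHw => u v wE; apply: (suf (b :: u)); rewrite wE.
have {}IH u v : w = u ++ ~~ b :: v ->
    - (a%:P * (marked a v)^`()) = spl true v (fun u v => vol u * (a%:P * marked a v)).
  move=> wE; case: (IH _ _ wE) => _; apply=> u' v' vE.
  by apply: (suf (b :: u ++ ~~ b :: u')); rewrite wE vE /= -catA.
have first : marked a w = vol w + spl true w (fun u v => vol u * (a%:P * marked a v))
    + spl false w (fun u v => vol u * marked a v).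
  rewrite /marked wsum_first vol_wsum; congr (_ + _ + _).
    by apply: eq_spl => u v _; rewrite vol_wsum.
  by apply: eq_spl => u v _; rewrite vol_wsum mul1r.
have -> : (marked a (b :: w))^`() = (if b then a%:P else 1) * (marked a w)^`() +
   ((-1) ^+ b * spl (~~ b) w (fun u v => vol u * marked a v) +
    spl (~~ b) w (fun u v => step_int b (vol u) * (marked a v)^`())).
  rewrite {1}/marked wsum_cons derivD derivM deriv_spl; congr (_ + _).
    by case: b {suf IH}; rewrite -?polyC1 derivC mul0r add0r.
  rewrite spl_mulr -splD; apply: eq_spl => u v _.
  by rewrite derivM deriv_step_int mulrA.
(* The marked letter is either [b] itself or comes after a first factor opened by [b]; in the second
   case the induction hypothesis applies after that factor. *)
have -> : spl true (b :: w) (fun u v => vol u * (a%:P * marked a v)) =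
    (if b then a%:P * marked a w else 0) -
    a%:P * spl (~~ b) w (fun u v => step_int b (vol u) * (marked a v)^`()).
  rewrite spl_cons vol_nil mul1r eqb_id -mulNr spl_mulr; congr (_ + _).
  under eq_spl => u v _.
    rewrite vol_cons mulrC spl_mulr.
    over.
  rewrite -spl_assoc; apply: eq_spl => u v wE.
  rewrite mulNr mulrCA -mulrN (IH _ _ wE) spl_mulr; apply: eq_spl => u' v' _.
  by rewrite mulrC -mulrA.
case: b suf {IH} => /= suf.
  have vw : vol w = 0 by exact: (suf [::]).
  rewrite [X in _ = a%:P * X - _]first vw add0r -[X in _ = a%:P * (X + _) - _]IHw expr1.
  by move: _^`() (spl _ _ _) (spl _ _ _) a%:P => x y z A; ring.
have e : a%:P * spl true w (fun u v => vol u * marked a v) =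
    spl true w (fun u v => vol u * (a%:P * marked a v)).
  by rewrite spl_mulr; apply: eq_spl => u v _; rewrite mulrCA.
rewrite expr0 !mul1r !mulrDr !opprD IHw e.
by move: (spl _ _ _) (a%:P * _) => x y; ring.
Qed.

(** The second hypothesis kills the terms whose first marked letter descends; besides the unmarked
    term, only those of [deriv_marked] remain. *)
Lemma markedE a w :
  (forall u v, w = u ++ true :: v -> vol v = 0) ->
  (forall u v, w = u ++ false :: v -> vol u = 0) ->
  marked a w = vol w - a%:P * (marked a w)^`().
Proof.
move=> suf pre; rewrite (deriv_marked _ suf) {1}/marked wsum_first.
rewrite -vol_wsum [X in _ + _ + X]spl0 ?addr0 => [|u v /pre]; last first.
  by rewrite vol_wsum => ->; rewrite mul0r.
by congr (_ + _); apply: eq_spl => u v _; rewrite vol_wsum.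
Qed.

(** Iterating [K = F - a K'] expands [K] in the derivatives of [F]; the remainder is a derivative of
    [K] and vanishes at high order. *)
Lemma marked_series a w n :
  (forall u v, w = u ++ true :: v -> vol v = 0) ->
  (forall u v, w = u ++ false :: v -> vol u = 0) ->
  (size (vol w) <= n)%N ->
  marked a w = \sum_(j < n) (- a) ^+ j *: (vol w)^`(j).
Proof.
move=> suf pre sn; have := markedE a suf pre.
set k := marked a w; set p := vol w => kE.
have iter N : k = \sum_(j < N) (- a) ^+ j *: p^`(j) + (- a) ^+ N *: k^`(N).
  elim: N => [|N IH]; first by rewrite big_ord0 add0r expr0 scale1r.
  rewrite big_ord_recr /= {1}IH -addrA; congr (_ + _).
  have e : k^`(N) = p^`(N) - a *: k^`(N.+1).
    by rewrite {1}kE derivnB mul_polyC derivnZ -derivSn derivnS.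
  by rewrite [in LHS]e scalerBr exprSr mulrN scaleNr scalerA.
have -> : k = \sum_(j < n + size k) (- a) ^+ j *: p^`(j).
  by rewrite {1}(iter (n + size k)%N) (@derivn_poly0 _ k) ?leq_addl // scaler0 addr0.
rewrite big_split_ord /= [X in _ + X]big1 ?addr0 // => i _.
by rewrite derivn_poly0 ?scaler0 // (leq_trans sn) ?leq_addr.
Qed.

(** * Alternating block words *)

Definition block_word l m := flatten (nseq m (nseq l true ++ nseq l false)).

Lemma block_wordS l m :
  block_word l m.+1 = nseq l true ++ nseq l false ++ block_word l m.
Proof. by rewrite /block_word /= catA. Qed.

Lemma count_block_word b l m : count_mem b (block_word l m) = (m * l)%N.
Proof.
elim: m => // m IH; rewrite block_wordS !count_cat IH !count_nseq.
by case: b {IH} => /=; lia.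
Qed.

Lemma block_word_prefix l m u v : block_word l m = u ++ v ->
  (count_mem false u <= count_mem true u)%N.
Proof.
elim: m u v => [|m IH] u v; first by case: u.
rewrite block_wordS.
have pre w : (forall x y, w = x ++ y -> (count_mem false x <= count_mem true x)%N) ->
    forall x y, nseq l true ++ nseq l false ++ w = x ++ y ->
    (count_mem false x <= count_mem true x)%N.
  move=> wP x y e.
  have {y e} -> : x = take (size x) (nseq l true ++ nseq l false ++ w).
    by rewrite e take_size_cat.
  move: (size x) => n; rewrite !take_cat !size_nseq; case: ltnP => nl.
    by rewrite take_nseq ?(ltnW nl) // !count_nseq.
  case: ltnP => nl2; first by rewrite take_nseq ?(ltnW nl2) // !count_cat !count_nseq /=; lia.
  have := wP _ _ (esym (cat_take_drop (n - l - l) w)).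
  by rewrite !count_cat !count_nseq /=; lia.
exact: pre IH u v.
Qed.

(** The prefix ending at this [true] lies strictly above the starting level, so [v] has a surplus of
    descending letters. *)
Lemma block_word_suffix_vol l m u v : block_word l m = u ++ true :: v -> vol v = 0.
Proof.
move=> e; apply: vol_unbalanced.
have := @block_word_prefix l m (rcons u true) v; rewrite cat_rcons => /(_ e).
have := @block_word_prefix l m u _ e.
have := count_block_word true l m; have := count_block_word false l m.
by rewrite e -cats1 !count_cat /=; lia.
Qed.

Lemma block_word_prefix_vol l m u v : block_word l m = u ++ false :: v -> vol u = 0.
Proof.
move=> e; apply: vol_unbalanced.
have := @block_word_prefix l m (rcons u false) v; rewrite cat_rcons => /(_ e).
by rewrite -cats1 !count_cat /=; lia.
Qed.

Lemma block_word_shift l m :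
  nseq l true ++ map negb (block_word l m) = block_word l m ++ nseq l true.
Proof.
elim: m => [|m IH]; first by rewrite cats0.
by rewrite block_wordS !map_cat !map_nseq /= IH !catA.
Qed.

Section MarkWeights.
Variables (R : comPzRingType) (ex : bool -> seq bool -> R) (a : R).

(** Only balanced factors contribute, so in each term the marked letters have the same excess of
    [true] over [false] as [w] itself. Moving the weight [a] from one kind of mark to the other thus
    changes all terms by the same power of [a]. *)
Lemma wsum_homogeneous w :
  (forall b u, count_mem true u != count_mem false u -> ex b u = 0) ->
  a ^+ count_mem false w * wsum (fun b => if b then a else 1) ex w =
  a ^+ count_mem true w * wsum (fun b => if b then 1 else a) ex w.
Proof.
move=> ex0; elim/word_ind: w => // b w IHw IH.
rewrite !wsum_cons !mulrDr; congr (_ + _).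
  case: b {IH}; rewrite /= add0n add1n exprS mul1r.
    by rewrite mulrCA IHw mulrA.
  by rewrite -mulrA IHw mulrCA.
rewrite !spl_mulr; apply: eq_spl => u v wE; case: (IH _ _ wE) => _ {IH}IHv.
have [ub|/(ex0 b)->] := eqVneq (count_mem true u) (count_mem false u);
  last by rewrite !mul0r !mulr0.
rewrite wE mulrCA [RHS]mulrCA; congr (_ * _).
have e c : count_mem c (b :: u ++ ~~ b :: v) = ((count_mem true u).+1 + count_mem c v)%N.
  by move: ub; rewrite /= count_cat /=; case: c b {wE} => [] [] /= ub; lia.
by rewrite !e !exprD -!mulrA IHv.
Qed.

(** A trailing [true] cannot open a factor, since no [false] follows, and a factor that it closes is
    opened by [false] and has weight 0. Hence it is marked, with weight 1. *)
Lemma wsum_cat_nseq_true mk l w :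
  mk true = 1 -> (forall u, ex false u = 0) ->
  wsum mk ex (w ++ nseq l true) = wsum mk ex w.
Proof.
move=> mk1 ex0; elim/word_ind: w => [|b w IHw IH].
  elim: l => //= l; rewrite !wsum_cons mk1 mul1r spl0 ?addr0 // => u v e.
  suff : false \in nseq l true by rewrite mem_nseq andbF.
  by rewrite e mem_cat mem_head orbT.
rewrite cat_cons !wsum_cons IHw; congr (_ + _).
case: b IH => IH; last by rewrite !spl0 // => u v _; rewrite ex0 mul0r.
rewrite spl_cat_nomem; last by rewrite mem_nseq andbF.
by apply: eq_spl => u v wE; case: (IH _ _ wE) => _ ->.
Qed.

Lemma wsum_nseq_true_cat mk l w :
  (forall u, ex true u = 0) ->
  wsum mk ex (nseq l true ++ w) = mk true ^+ l * wsum mk ex w.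
Proof.
move=> ex0; elim: l => [|l IH]; first by rewrite mul1r.
rewrite cat_cons wsum_cons IH exprS mulrA spl0 ?addr0 // => u v _.
by rewrite ex0 mul0r.
Qed.

End MarkWeights.

Lemma horner_marked a w x :
  (marked a w).[x] =
  wsum (fun b => if b then a else 1) (fun b u => (step_int b (vol u)).[x]) w.
Proof.
rewrite -horner_evalE rmorph_wsum; apply: wsum_ext => // -[] /=.
  by rewrite /horner_eval hornerC.
by rewrite /horner_eval hornerE.
Qed.

Lemma unit_int_vol_negb w : unit_int (vol (map negb w)) = unit_int (vol w).
Proof.
have : (reflect_poly (step_int false (vol w))).[0] = (step_int true (vol (map negb w))).[0].
  by rewrite step_int_reflect vol_negb.
rewrite step_int0 /reflect_poly horner_comp hornerD hornerN.
by rewrite hornerX hornerC subr0 step_int1 => <-.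
Qed.

(** At 1 the integrals over ascending steps vanish, so the first [l] letters are marked and give
    [a ^+ l]. Negating the letters of the rest gives [block_word l m] followed by [l] ascending
    letters, whose marks now have weight 1 and drop out. Reflection turns the factors into their
    values at 0, and [wsum_homogeneous] moves [a] back to the ascending marks, both letters being
    equally frequent. *)
Lemma marked_block_word l m a : a != 0 ->
  (marked a (block_word l m.+1)).[1] = a ^+ l * (marked a (block_word l m)).[0].
Proof.
move=> a0; rewrite !horner_marked block_wordS wsum_nseq_true_cat => [|u]; last first.
  by rewrite step_int1.
congr (_ * _); rewrite -[X in wsum _ _ X](mapK negbK) wsum_negb.
rewrite map_cat map_nseq /= block_word_shift wsum_cat_nseq_true //= => [|u]; last first.
  by rewrite step_int1.
set ex0 := fun b u => (step_int b (vol u)).[0].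
have -> : wsum (fun b => if b then a else 1) ex0 (block_word l m) =
    wsum (fun b => if b then 1 else a) ex0 (block_word l m).
  apply: (@mulfI _ (a ^+ (m * l))); first by rewrite expf_neq0.
  have := @wsum_homogeneous _ ex0 a (block_word l m); rewrite !count_block_word.
  apply=> b u /vol_unbalanced vu; by rewrite /ex0 vu linear0 horner0.
apply: wsum_ext => [[]|b u] //; rewrite /ex0 step_int0 step_int1.
by case: b; rewrite // unit_int_vol_negb.
Qed.

(** * The integral of the volume of a block word *)

Lemma derivn_large (p : {poly rat}) j a : (size p <= j)%N -> (p^`(j)).[a] = 0.
Proof. by move=> pj; rewrite derivn_poly0 // horner0. Qed.

Lemma fact_neq0 n : (n`!%:R : rat) != 0.
Proof. by rewrite pnatr_eq0 -lt0n fact_gt0. Qed.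

Lemma sum_tail (F : nat -> rat) n n' :
  (n <= n')%N -> (forall k, (n <= k)%N -> F k = 0) ->
  \sum_(k < n') F k = \sum_(k < n) F k.
Proof.
move=> /subnKC <- F0; rewrite big_split_ord /= [X in _ + X]big1 ?addr0 // => i _.
by rewrite F0 ?leq_addr.
Qed.

Lemma taylor1 (p : {poly rat}) n : (size p <= n)%N ->
  p.[0] = \sum_(k < n) (-1) ^+ k * (p^`(k)).[1] / k`!%:R.
Proof.
move=> pn; rewrite -(subrr 1) (nderiv_taylor_wide _ pn); last exact: mulrC.
apply: eq_bigr => k _; rewrite nderivn_def hornerMn -[in RHS]mulr_natr.
by rewrite mulrA mulfK ?fact_neq0 // mulrC.
Qed.

Lemma poly_eq_nonzero (p q : {poly rat}) :
  (forall a, a != 0 -> p.[a] = q.[a]) -> p = q.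
Proof.
move=> pq; apply/eqP; rewrite -subr_eq0; apply/eqP.
apply: (@roots_geq_poly_eq0 _ _ [seq i.+1%:R | i <- iota 0 (size (p - q))]).
- apply/allP => _ /mapP[i _ ->]; rewrite rootE hornerD hornerN pq ?subrr //.
  by rewrite pnatr_eq0.
- rewrite map_inj_uniq ?iota_uniq // => i j /eqP; rewrite eqr_nat eqSS; exact: eqP.
- by rewrite size_map size_iota.
Qed.

(* [bcoef l m i] is [i!] times the coefficient of [y ^+ i] in the volume
   polynomial of the block word evaluated at [1 - y]. *)
Definition bcoef l m i : rat := (-1) ^+ i * ((vol (block_word l m))^`(i)).[1].

Lemma bcoef0 l i : bcoef l 0 i = (i == 0%N)%:R.
Proof.
rewrite /bcoef vol_nil; case: i => [|i]; first by rewrite mul1r derivn0 hornerC.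
by rewrite derivn_large ?mulr0 ?size_poly1.
Qed.

(** Through [marked_series], [marked_block_word] is an identity between polynomials in [a]. Its
    coefficients relate derivatives at 1 for [m.+1] to derivatives at 0 for [m], and the latter are
    expanded by Taylor's formula at 1. *)
Lemma bcoef_rec_large l m i n : (size (vol (block_word l m)) <= n)%N ->
  bcoef l m.+1 i =
  if (i < l)%N then 0 else \sum_(k < n) bcoef l m (i - l + k) / k`!%:R.
Proof.
set p := vol _ => pn; set q := vol (block_word l m.+1).
(* A common bound on both sizes, so that both series have the same range. *)
pose N := (size p + size q)%N.
pose c j : rat := (-1) ^+ j * (p^`(j)).[0].
have series : \poly_(j < N) bcoef l m.+1 j = 'X^l * \poly_(j < N) c j.
  apply: poly_eq_nonzero => a a0.
  rewrite hornerM hornerXn !horner_poly; have := marked_block_word l m a0.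
  rewrite !(@marked_series _ _ N) ?leq_addr ?leq_addl //;
    try exact: block_word_suffix_vol; try exact: block_word_prefix_vol.
  rewrite !horner_sum -/p -/q => e; transitivity
    (\sum_(j < N) ((- a) ^+ j *: q^`(j)).[1]).
    by apply: eq_bigr => j _; rewrite hornerZ /bcoef -/q [(- a) ^+ j]exprNn mulrAC.
  rewrite e; congr (_ * _); apply: eq_bigr => j _.
  by rewrite hornerZ /c [(- a) ^+ j]exprNn mulrAC.
have bcoefE : bcoef l m.+1 i = (\poly_(j < N) bcoef l m.+1 j)`_i.
  rewrite coef_poly; case: ltnP => // iN; rewrite /bcoef derivn_large ?mulr0 //.
  by apply: leq_trans iN; rewrite leq_addl.
rewrite bcoefE series coefXnM; case: ltnP => // li.
have -> : (\poly_(j < N) c j)`_(i - l) = c (i - l)%N.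
  rewrite coef_poly; case: ltnP => // iN; rewrite /c derivn_large ?mulr0 //.
  by apply: leq_trans iN; rewrite leq_addr.
rewrite /c (@taylor1 _ n) ?mulr_sumr => [|]; last first.
  apply: leq_trans pn; elim: (i - l)%N => [|j IH]; first by rewrite derivn0.
  apply: leq_trans IH; rewrite derivnS.
  by case: (eqVneq p^`(j) 0) => [->|/lt_size_deriv/ltnW //]; rewrite deriv0.
apply: eq_bigr => k _; rewrite /bcoef -/p exprD !mulrA; congr (_ * _ / _).
by rewrite /derivn [(i - l + k)%N]addnC iterD.
Qed.

Lemma bcoef_support l m i : (m * l < i)%N -> bcoef l m i = 0.
Proof.
elim: m i => [|m IH] i mi; first by rewrite bcoef0; case: i mi.
rewrite (bcoef_rec_large _ (leqnn _)); case: ltnP => // li.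
by rewrite big1 // => k _; rewrite IH ?mul0r //; lia.
Qed.

Lemma bcoef_rec l m i n : (m * l < n)%N ->
  bcoef l m.+1 i =
  if (i < l)%N then 0 else \sum_(k < n) bcoef l m (i - l + k) / k`!%:R.
Proof.
move=> mn; set s := size (vol (block_word l m)).
rewrite (@bcoef_rec_large _ _ _ (n + s)); last exact: leq_addl.
case: ltnP => // li.
apply: (@sum_tail (fun k => bcoef l m (i - l + k) / k`!%:R)); first exact: leq_addr.
by move=> k nk; rewrite bcoef_support ?mul0r //; lia.
Qed.

(** Taylor's formula at 1 for the antiderivative, which vanishes at 0: the term of order 0 is the
    integral, the others are the summands with opposite sign. *)
Lemma unit_int_vol l m n : (m * l < n)%N ->
  unit_int (vol (block_word l m)) = \sum_(k < n) bcoef l m k / k.+1`!%:R.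
Proof.
move=> mn; set p := vol _; set s := (n + size p)%N.
have : (prim p).[0] = 0 by exact: horner0_prim.
rewrite (@taylor1 _ s.+1); last first.
  by rewrite (leq_trans (size_poly _ _)) // ltnS leq_addl.
rewrite big_ord_recl [X in X + _](_ : _ = unit_int p); last by rewrite /= mul1r divr1.
under eq_bigr => k _ do rewrite lift0 derivSn deriv_prim exprS mulN1r !mulNr.
rewrite sumrN => /eqP; rewrite subr_eq0 => /eqP ->.
apply: (@sum_tail (fun k => bcoef l m k / k.+1`!%:R)); first exact: leq_addr.
by move=> k nk; rewrite bcoef_support ?mul0r //; lia.
Qed.

(** * Sequences of box contents and the multinomial formula *)

Definition nat_seqs B m : seq (seq nat) :=
  iter m (fun S => [seq b :: s | b <- iota 0 B, s <- S]) [:: [::]].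

Lemma mem_nat_seqs B m s :
  (s \in nat_seqs B m) = (size s == m) && all (fun b => b < B)%N s.
Proof.
elim: m s => [|m IH] [|b s] //=.
  by apply/negbTE/negP => /allpairsP[[]] ? ? [].
apply/allpairsP/andP => [[[c t] /= [+ + [-> ->]]]|[/eqP[sm] /andP[bB sB]]].
  by rewrite mem_iota IH => /= cB /andP[/eqP-> ->]; rewrite eqxx -(add0n B) cB.
by exists (b, s); rewrite /= mem_iota bB IH sm eqxx sB.
Qed.

Lemma nat_seqs_uniq B m : uniq (nat_seqs B m).
Proof.
elim: m => //= m IH; apply: allpairs_uniq => //; first exact: iota_uniq.
by move=> [b s] [b' s'] _ _ [-> ->].
Qed.

Lemma big_nat_seqs (V : nmodType) (P : pred (seq nat)) (F : seq nat -> V) B m :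
  \sum_(s <- nat_seqs B m.+1 | P s) F s =
  \sum_(b < B) \sum_(s <- nat_seqs B m | P ((b : nat) :: s)) F ((b : nat) :: s).
Proof.
have iotaE : iota 0 B = index_iota 0 B by rewrite /index_iota subn0.
rewrite big_mkcond /= big_allpairs_dep iotaE big_mkord.
by apply: eq_bigr => b _; rewrite [RHS]big_mkcond.
Qed.

(** For [s] of sum [n], this is the multinomial coefficient divided by [n!]: the functions from [n]
    points to the boxes with contents [s] number [n!] times the weight. *)
Definition fact_weight (s : seq nat) : rat := \prod_(b <- s) (b`!%:R)^-1.

Lemma fact_weight_cons b s : fact_weight (b :: s) = (b`!%:R)^-1 * fact_weight s.
Proof. exact: big_cons. Qed.

(** The multinomial theorem, adding one box at a time by the binomial formula. As [n < B], the bound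
    on the entries excludes nothing. *)
Lemma sum_fact_weight B m n : (n < B)%N ->
  \sum_(s <- nat_seqs B m | sumn s == n) fact_weight s = m%:R ^+ n / n`!%:R.
Proof.
elim: m n => [|m IH] n nB.
  rewrite /= big_mkcond big_seq1 /= /fact_weight big_nil.
  by case: n {nB} => [|n]; rewrite ?divr1 //= expr0n /= mul0r.
rewrite big_nat_seqs -(addn1 m) natrD exprDn mulr_suml.
rewrite (@sum_tail (fun b => \sum_(s <- nat_seqs B m | sumn (b :: s) == n)
    fact_weight (b :: s)) n.+1) //; last first.
  move=> k nk; rewrite big1 // => s /eqP /= e; exfalso; lia.
apply: eq_bigr => -[k] /= kn _; rewrite ltnS in kn.
have e s : (k + sumn s == n) = (sumn s == (n - k)%N) by lia.
under eq_bigl => s do rewrite e.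
under eq_bigr => s _ do rewrite fact_weight_cons.
rewrite -mulr_sumr IH; last by lia.
rewrite expr1n mulr1 -mulr_natr -(bin_fact kn) !natrM.
have := fact_neq0 k; have := fact_neq0 (n - k).
have : ('C(n, k)%:R : rat) != 0 by rewrite pnatr_eq0 -lt0n bin_gt0.
 by move=> c0 nk0 k0; field; rewrite nk0 k0 c0.
Qed.

(** * The cycle lemma *)

Definition raney l (s : seq nat) :=
  [forall i : 'I_(size s), (l * i.+1 < sumn (take i.+1 s))%N].

Lemma raneyP l s :
  reflect (forall i, (0 < i <= size s)%N -> (l * i < sumn (take i s))%N) (raney l s).
Proof.
apply: (iffP forallP) => [H [|i] //= si|H i]; last by apply: H; rewrite ltn_ord.
exact: (H (Ordinal si)).
Qed.

Lemma sumn_take_rot s r i : (r <= size s)%N -> (i <= size s)%N ->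
  (sumn (take r s) + sumn (take i (rot r s)))%N = sumn (take (r + i) (s ++ s)).
Proof.
move=> rs im; rewrite takeD sumn_cat; congr (_ + sumn _)%N.
  by rewrite takel_cat.
rewrite drop_cat /rot; case: ltnP => [lt|ge].
  rewrite !take_cat size_drop; case: ltnP => // ge.
  by rewrite take_takel //; lia.
have -> : r = size s by lia.
by rewrite drop_size subnn take_size drop0.
Qed.

(* The good rotation starts at the last minimum of the walk [sumn (take n (s ++ s)) - l * n]. *)
Lemma cycle_lemma l m s : (0 < m)%N -> size s = m -> sumn s = (l * m).+1 ->
  exists! r : 'I_m, raney l (rot r s).
Proof.
move=> m0 sm ss.
pose D n : int := (sumn (take n (s ++ s)))%:Z - (l * n)%:Z.
(* A full turn raises the walk by one, since the total is [l * m + 1]. *)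
have Dm n : (n <= m)%N -> D (m + n)%N = D n + 1.
  move=> nm; rewrite /D takeD -{1 3}sm take_size_cat // drop_size_cat // sumn_cat ss.
  by rewrite takel_cat ?sm //; lia.
have goodP (r : 'I_m) : reflect (forall i, (0 < i <= m)%N -> D r < D (r + i)%N)
    (raney l (rot r s)).
  have rs : (r <= size s)%N by rewrite sm ltnW.
  have DE i : (i <= m)%N -> D (r + i)%N = D r + (sumn (take i (rot r s)))%:Z - (l * i)%:Z.
    by move=> im; rewrite /D -(sumn_take_rot rs) ?sm // takel_cat //; lia.
  apply: (iffP (raneyP _ _)); rewrite size_rot sm => H i im; have := H i im.
    by rewrite DE; [lia|case/andP: im].
  by rewrite DE; [lia|case/andP: im].
(* Good starts [r < r'] would give [D r < D r' < D r + 1], impossible for integers. *)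
have uni (r r' : 'I_m) : raney l (rot r s) -> raney l (rot r' s) -> (r <= r')%N -> r = r'.
  move=> /goodP gr /goodP gr'; rewrite leq_eqVlt => /orP[/eqP/val_inj//|rr'].
  have l1 := ltn_ord r; have l2 := ltn_ord r'.
  have h1 : D r < D r' by have := gr (r' - r)%N; rewrite subnKC ?(ltnW rr') //; apply; lia.
  have h2 : D r' < D (m + r)%N.
    have := gr' (m + r - r')%N; rewrite subnKC; last by lia.
    by apply; lia.
  by move: h2; rewrite Dm ?(ltnW l1) //; lia.
have [r good] : exists r : 'I_m, raney l (rot r s).
  (* On this range [D] is at least [- (l * m)], so the shift makes it a natural number and [absz]
     loses nothing. *)
  have [r0 _ r0P] := @arg_minnP _ (Ordinal m0) xpredT (fun r : 'I_m => absz (D r + (l * m)%:Z)) isT.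
  have r0min (i : 'I_m) : D r0 <= D i.
    have := r0P i isT; have := ltn_ord i; have := ltn_ord r0; rewrite /D.
    by nia.
  pose P (i : 'I_m) := D i == D r0.
  have [r rP rmax] := @arg_maxnP _ r0 P (fun i : 'I_m => i : nat) (eqxx _).
  exists r; apply/goodP => i /andP[i0 im].
  have lr := ltn_ord r; rewrite (eqP rP).
  case: (ltnP (r + i) m) => h.
    rewrite lt_neqAle (r0min (Ordinal h)) andbT; apply/eqP => e.
    by have := rmax (Ordinal h); rewrite /P /= e eqxx => /(_ isT); lia.
  have h' : (r + i - m < m)%N by lia.
  have -> : (r + i = m + (r + i - m))%N by lia.
  by rewrite Dm ?(ltnW h') //; have := r0min (Ordinal h'); rewrite /=; lia.
exists r; split=> // r' good'; case: (leqP r r') => h; first exact: uni.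
by apply/esym/uni => //; exact: ltnW.
Qed.

(** This unrolls [bcoef_rec]: the current index [n] loses [l] and gains the next entry. The last
    index must be [l], the only one where [bcoef l 1] is nonzero. *)
Fixpoint stays l n s :=
  if s is b :: s' then (l <= n)%N && stays l (n - l + b)%N s' else n == l.

Lemma staysP l n s :
  reflect ((n + sumn s = l * (size s).+1)%N /\
           forall i, (i <= size s)%N -> (l * i.+1 <= n + sumn (take i s))%N)
          (stays l n s).
Proof.
elim: s n => [|b s IH] n /=.
  rewrite addn0 muln1; apply: (iffP eqP) => [->|[] //]; split=> // i.
  by rewrite leqn0 => /eqP ->; rewrite /=; lia.
apply: (iffP andP) => [[ln /IH[e H]]|[e H]].
  split=> [|[|i] hi]; first by lia.
    by rewrite take0 /=; lia.
  by have := H i hi; rewrite /=; lia.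
have ln : (l <= n)%N by have := H 0%N isT; rewrite take0 /=; lia.
split=> //; apply/IH; split=> [|i hi]; first by lia.
by have := H i.+1 hi; rewrite /=; lia.
Qed.

Lemma bcoef_stays l m n B : (m * l < B)%N ->
  bcoef l m.+1 n = \sum_(s <- nat_seqs B m | stays l n s) fact_weight s.
Proof.
elim: m n => [|m IH] n mB.
  rewrite (@bcoef_rec _ _ _ 1) // big_ord1 addn0 divr1 bcoef0 big_mkcond big_seq1 /=.
  rewrite /fact_weight big_nil subn_eq0.
  by case: ltngtP.
rewrite (bcoef_rec _ mB) big_nat_seqs; case: ltnP => ln.
  by rewrite big1 // => b _; rewrite big1 // => s; rewrite /= leqNgt ln.
apply: eq_bigr => b _; rewrite IH; last by lia.
rewrite mulrC mulr_sumr /= ln; apply: eq_bigr => s _; by rewrite fact_weight_cons.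
Qed.

(** Taking one point out of the first box turns strict inequalities into weak ones. *)
Lemma raney_stays l b s :
  (0 < b)%N && stays l b.-1 s =
  (sumn (b :: s) == (l * (size s).+1).+1) && raney l (b :: s).
Proof.
apply/idP/idP => [/andP[b0 /staysP[e H]]|/andP[/eqP e /raneyP H]].
  apply/andP; split; first by rewrite /=; lia.
  by apply/raneyP => -[|i] //= hi; have := H i hi; lia.
have b0 : (0 < b)%N by have := H 1%N isT; rewrite /= take0 /=; lia.
rewrite b0; apply/staysP; split; first by move: e; rewrite /=; lia.
by move=> i hi; have := H i.+1 hi; rewrite /=; lia.
Qed.

(** The factor [1 / (k + 1)!] of [unit_int_vol] puts [k + 1] points into the first box, while [k] is
    the starting index of [stays]; sequences starting with 0 are not [raney]. *)
Lemma unit_int_vol_raney l m B : (m.+1 * l < B)%N ->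
  unit_int (vol (block_word l m.+1)) =
  \sum_(s <- nat_seqs B.+1 m.+1 | (sumn s == (l * m.+1).+1) && raney l s) fact_weight s.
Proof.
move=> mB; rewrite (unit_int_vol mB) big_nat_seqs big_ord_recl.
rewrite [X in _ = X + _]big_seq_cond [X in _ = X + _]big1 ?add0r => [|s]; last first.
  by rewrite mem_nat_seqs => /andP[/andP[/eqP <- _] P]; have := etrans (raney_stays l 0 s) P.
apply: eq_bigr => b _; rewrite (@bcoef_stays _ _ _ B.+1); last by lia.
rewrite lift0 mulr_suml big_seq_cond [RHS]big_seq_cond; apply: eq_big => s.
  case: (boolP (s \in _)) => //=; rewrite mem_nat_seqs => /andP[/eqP <- _].
  by rewrite -(raney_stays l b.+1 s).
by move=> _; rewrite fact_weight_cons mulrC.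
Qed.

Lemma fact_weight_rot r s : fact_weight (rot r s) = fact_weight s.
Proof. by apply: perm_big; rewrite perm_rot. Qed.

(** Multiplication by [m] sums over all rotations, which preserve weight and total. By the cycle
    lemma each sequence is then counted once, and [sum_fact_weight] applies. *)
Lemma sum_raney l m B : (0 < m)%N -> ((l * m).+1 < B)%N ->
  \sum_(s <- nat_seqs B m | (sumn s == (l * m).+1) && raney l s) fact_weight s =
  m%:R ^+ (l * m) / (l * m).+1`!%:R.
Proof.
move=> m0 mB; set X := LHS.
have m0' : (m%:R : rat) != 0 by rewrite pnatr_eq0 -lt0n.
suff : m%:R * X = m%:R ^+ (l * m).+1 / (l * m).+1`!%:R.
  by rewrite exprS -mulrA => /(mulfI m0').
rewrite -(sum_fact_weight m mB).
transitivity (\sum_(s <- nat_seqs B m | sumn s == (l * m).+1)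
    \sum_(r < m | raney l (rot r s)) fact_weight s); last first.
  rewrite big_seq_cond [RHS]big_seq_cond; apply: eq_bigr => s /andP[].
  rewrite mem_nat_seqs => /andP[/eqP sm _] /eqP ss.
  have [r [rP uniq_r]] := cycle_lemma m0 sm ss.
  by rewrite (big_pred1 r) // => r'; apply/idP/eqP => [/uniq_r|->].
rewrite (exchange_big_dep xpredT) //=.
transitivity (\sum_(r < m) X).
  by rewrite sumr_const card_ord mulr_natl.
apply: eq_bigr => r _; rewrite /X.
have perm_rots : perm_eq (nat_seqs B m) [seq rot r s | s <- nat_seqs B m].
  apply: uniq_perm; rewrite ?nat_seqs_uniq ?map_inj_uniq ?nat_seqs_uniq //.
    exact: rot_inj.
  move=> s; apply/idP/mapP => [|[t + ->]]; rewrite !mem_nat_seqs; last first.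
    by rewrite size_rot (eq_all_r (mem_rot r t)).
  by exists (rotr r s); rewrite ?mem_nat_seqs ?size_rotr ?rotrK ?(eq_all_r (mem_rotr r s)).
rewrite (perm_big _ perm_rots) big_map.
apply: eq_big => s; last by rewrite fact_weight_rot.
by congr (_ && _); rewrite (perm_sumn (permEl (perm_rot _ _))).
Qed.

Theorem unit_int_vol_block_word l m : (0 < m)%N ->
  unit_int (vol (block_word l m)) = m%:R ^+ (m * l) / (m * l).+1`!%:R.
Proof.
case: m => // m _; rewrite (unit_int_vol_raney (leqnn _)) [in RHS]mulnC.
by apply: sum_raney => //; lia.
Qed.

(** * Counting the labelings of a signed tree *)

Lemma big_nat_seqs_cat (V : nmodType) (F : seq nat -> V) B m n :
  \sum_(s <- nat_seqs B (m + n)) F s =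
  \sum_(s1 <- nat_seqs B m) \sum_(s2 <- nat_seqs B n) F (s1 ++ s2).
Proof.
elim: m F => [|m IH] F; first by rewrite big_seq1.
by rewrite addSn !big_nat_seqs; apply: eq_bigr => b _; rewrite IH.
Qed.

Definition step b (x y : nat) := if b then (x < y)%N else (y < x)%N.

(* [labels_ok t r l]: reading the labels of the non-root vertices of [t] from
   [l] in preorder, with root label [r], every edge has the right direction. *)
Fixpoint labels_ok t (r : nat) (l : seq nat) : bool :=
  if t is Br b t1 t2 then
    if l is y :: l' then
      [&& step b r y, labels_ok t1 y (take (edges t1) l')
        & labels_ok t2 r (drop (edges t1) l')]
    else false
  else l == [::].

Definition label_set M (l : seq nat) : {set 'I_M} := [set i : 'I_M | (i : nat) \in l].

Definition nb_labelings M t r (A : {set 'I_M}) : rat :=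
  \sum_(l <- nat_seqs M (edges t)) [&& uniq l, label_set M l == A & labels_ok t r l]%:R.

Lemma label_set_cons M (y : 'I_M) l : label_set M ((y : nat) :: l) = y |: label_set M l.
Proof. by apply/setP => i; rewrite !inE. Qed.

Lemma label_set_cat M l1 l2 :
  label_set M (l1 ++ l2) = label_set M l1 :|: label_set M l2.
Proof. by apply/setP => i; rewrite !inE mem_cat. Qed.

Lemma card_label_set M l :
  uniq l -> all (fun b => b < M)%N l -> #|label_set M l| = size l.
Proof.
elim: l => [|b l IH] /=.
  by move=> _ _; apply: eq_card0 => i; rewrite !inE.
case/andP => bl ul /andP[bM lM].
by rewrite (label_set_cons (Ordinal bM)) cardsU1 IH // inE /= bl.
Qed.

Lemma nb_labelings_card M t r (A : {set 'I_M}) :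
  #|A| != edges t -> nb_labelings t r A = 0.
Proof.
move=> At; rewrite /nb_labelings big_seq big1 // => l; rewrite mem_nat_seqs => /andP[/eqP sl lM].
case: (boolP (uniq l)) => //= ul; case: eqP => //= lA.
by rewrite -lA card_label_set // sl eqxx in At.
Qed.

(** Here [B] is the set of labels in the branch of the first child, and [y] the label of that
    child. *)
Lemma nb_labelings_Br M b t1 t2 r (A : {set 'I_M}) :
  nb_labelings (Br b t1 t2) r A =
  \sum_(B : {set 'I_M} | B \subset A)
    (\sum_(y in B | step b r y) nb_labelings t1 y (B :\ y)) *
    nb_labelings t2 r (A :\: B).
Proof.
pose c (B : {set 'I_M}) (y : 'I_M) l1 l2 :=
  [&& B \subset A, (y \in B) && step b r y,
      [&& uniq l1, label_set M l1 == B :\ y & labels_ok t1 y l1]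
    & [&& uniq l2, label_set M l2 == A :\: B & labels_ok t2 r l2]].
have cE (B : {set 'I_M}) : (if B \subset A then
      (\sum_(y in B | step b r y) nb_labelings t1 y (B :\ y)) *
      nb_labelings t2 r (A :\: B) else 0) =
    \sum_y \sum_(l1 <- nat_seqs M (edges t1)) \sum_(l2 <- nat_seqs M (edges t2))
      (c B y l1 l2)%:R.
  rewrite big_mkcond big_distrl /=; case: (boolP (B \subset A)) => BA; last first.
    rewrite big1 // => y _; rewrite big1 // => l1 _; rewrite big1 // => l2 _.
    by rewrite /c (negPf BA).
  apply: eq_bigr => y _; rewrite /c BA /=; case: andP => _; last first.
    by rewrite mul0r big1 // => l1 _; rewrite big1.
  rewrite big_distrl; apply: eq_bigr => l1 _; rewrite big_distrr; apply: eq_bigr => l2 _.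
  by rewrite /= -natrM mulnb.
rewrite big_mkcond /=; under [RHS]eq_bigr => B _ do rewrite cE.
rewrite [RHS]exchange_big /= {1}/nb_labelings big_nat_seqs; apply: eq_bigr => y _.
rewrite big_nat_seqs_cat [RHS]exchange_big /=; apply: eq_big_seq => l1.
rewrite mem_nat_seqs => /andP[/eqP s1 M1].
rewrite [RHS]exchange_big /=; apply: eq_big_seq => l2.
rewrite mem_nat_seqs => /andP[/eqP s2 M2].
rewrite /= (take_size_cat _ s1) (drop_size_cat _ s1) label_set_cons label_set_cat.
(* Once [y] and [l1] are fixed, this is the only [B] that contributes. *)
pose B0 := y |: label_set M l1.
rewrite (bigD1 B0) //= [X in _ + X]big1 ?addr0 => [|B BB0]; last first.
  rewrite (_ : c B y l1 l2 = false) //; apply: contraNF BB0.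
  move=> /and4P[_ /andP[yB _] /and3P[_ /eqP e _] _].
  by rewrite /B0 e setD1K.
congr (_%:R); congr nat_of_bool; rewrite /c -/B0.
rewrite (_ : (y \in B0) = true) ?setU11 //=.
rewrite cat_uniq mem_cat negb_or.
have memE i l : (i : 'I_M) \in label_set M l = ((i : nat) \in l) by rewrite inE.
have hasE : has (mem l1) l2 = ~~ [disjoint label_set M l1 & label_set M l2].
  rewrite -setI_eq0; apply/hasP/set0Pn => [[x x2 x1]|[i]]; last first.
    by rewrite in_setI !memE => /andP[i1 i2]; exists (i : nat).
  have xM : (x < M)%N by exact: (allP M1).
  by exists (Ordinal xM); rewrite in_setI !memE x2 andbT.
have y1E : (label_set M l1 == B0 :\ y) = ((y : nat) \notin l1).
  apply/eqP/idP => [e|yl]; first by rewrite -memE e !inE eqxx.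
  by rewrite /B0 setU1K // memE.
have AE : [&& B0 \subset A & label_set M l2 == A :\: B0] =
    [&& [disjoint B0 & label_set M l2] & B0 :|: label_set M l2 == A].
  apply/andP/andP => [[BA /eqP ->]|[dis /eqP <-]]; split.
  - by rewrite -setI_eq0 setDE setIC -setIA [_ :&: B0]setIC setICr setI0.
  - by rewrite -{2}(setID A B0) (setIidPr BA).
  - exact: subsetUl.
  - by rewrite setDUl setDv set0U; apply/eqP/esym/setDidPl; rewrite disjoint_sym.
have disE : [disjoint B0 & label_set M l2] = ((y : nat) \notin l2) && ~~ has (mem l1) l2.
  by rewrite hasE negbK -[LHS]setI_eq0 setIUl setU_eq0 !setI_eq0 disjoints1 memE.
rewrite y1E setUA -/B0.
transitivity [&& ((y : nat) \notin l1), step b r y, uniq l1, labels_ok t1 y l1, uniq l2,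
    labels_ok t2 r l2, ([disjoint B0 & label_set M l2]) & B0 :|: label_set M l2 == A].
  rewrite disE; move: (has (mem l1) l2) ((y : nat) \notin l1) ((y : nat) \notin l2).
  move: (uniq l1) (uniq l2) (step b r y) (labels_ok t1 y l1) (labels_ok t2 r l2).
  by move: (_ == A); do 9!case.
rewrite -AE; move: (uniq l1) (uniq l2) (step b r y) (labels_ok t1 y l1) (labels_ok t2 r l2).
by move: (_ == A :\: B0) (B0 \subset A) ((y : nat) \notin l1); do 8!case.
Qed.

(** * From labelings to volumes *)

(** Coefficients in a Bernstein basis: for a fixed relative order of [d] labels, [a] of them below
    the root label [x], the volume is [x ^ a (1 - x) ^ (d - a)] divided by [a! (d - a)!]. *)
Definition homog d (p : {poly rat}) : {poly rat} :=
  \sum_(a < d.+1) p`_a *: ('X^a * (1 - 'X) ^+ (d - a)).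

Fact homog_is_linear d : linear (homog d).
Proof.
move=> c p q; rewrite /homog scaler_sumr -big_split; apply: eq_bigr => a _.
by rewrite coefD coefZ scalerDl scalerA.
Qed.
HB.instance Definition _ d :=
  GRing.isLinear.Build rat {poly rat} {poly rat} *:%R (homog d) (homog_is_linear d).

Lemma homogXn d a : (a <= d)%N -> homog d 'X^a = 'X^a * (1 - 'X) ^+ (d - a).
Proof.
move=> ad; rewrite /homog (bigD1 (Ordinal (ad : (a < d.+1)%N))) //= coefXn eqxx scale1r.
by rewrite big1 ?addr0 // => b; rewrite -val_eqE coefXn /= => /negPf->; rewrite scale0r.
Qed.

Lemma homogM d e (p q : {poly rat}) : (size p <= d.+1)%N -> (size q <= e.+1)%N ->
  homog (d + e) (p * q) = homog d p * homog e q.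
Proof.
move=> pd qe.
have expand n (f : {poly rat}) : (size f <= n.+1)%N -> f = \sum_(a < n.+1) f`_a *: 'X^a.
  move=> fn; rewrite -poly_def; apply/polyP => i; rewrite coef_poly.
  by case: ltnP => // ni; rewrite nth_default // (leq_trans fn).
rewrite {1}(expand _ _ pd) {1}(expand _ _ qe) big_distrlr linear_sum /homog big_distrlr.
apply: eq_bigr => a _; rewrite linear_sum; apply: eq_bigr => b _ /=.
rewrite -scalerAl -scalerAr scalerA linearZ /= -exprD.
have ad := ltn_ord a; have be := ltn_ord b.
rewrite homogXn; last by lia.
rewrite -scalerAl -scalerAr scalerA (_ : d + e - (a + b) = (d - a) + (e - b))%N; last by lia.
by rewrite !exprD; congr (_ *: _); ring.
Qed.

Lemma horner_homog d p x :
  (homog d p).[x] = \sum_(a < d.+1) p`_a * (x ^+ a * (1 - x) ^+ (d - a)).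
Proof.
rewrite /homog horner_sum; apply: eq_bigr => a _.
by rewrite hornerZ hornerM hornerXn horner_exp hornerD hornerN hornerX hornerC.
Qed.

Lemma homog_at0 d p : (homog d p).[0] = p`_0.
Proof.
rewrite horner_homog big_ord_recl big1 => [|a _].
  by rewrite subr0 expr1n expr0 !mulr1.
by rewrite lift0 expr0n mul0r mulr0.
Qed.

Lemma homog_at1 d p : (homog d p).[1] = p`_d.
Proof.
rewrite horner_homog big_ord_recr big1 /= ?add0r => [|a _].
  by rewrite subnn expr1n !mulr1.
by rewrite subrr expr0n subn_eq0 leqNgt ltn_ord !mulr0.
Qed.

(** In the label set of a branch, [a] labels are below that of its top vertex and [i] are below the
    root label; this compares the two vertices. *)
Definition rank_cond b (i a : nat) := if b then (i <= a)%N else (a < i)%N.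

(** Factorials convert coefficients into counts of labelings; the counts are summed over the
    admissible ranks of the child and converted back in degree [d.+1]. *)
Definition homog_int b d (p : {poly rat}) : {poly rat} :=
  \poly_(i < d.+2) ((\sum_(a < d.+1 | rank_cond b i a) (a`! * (d - a)`!)%:R * p`_a) /
                    (i`! * (d.+1 - i)`!)%:R).

Lemma fact2_neq0 i j : ((i`! * j`!)%:R : rat) != 0.
Proof. by rewrite natrM mulf_neq0 ?fact_neq0. Qed.

Lemma cancel_denom (x y z : rat) : x != 0 -> x * (y / (x * z)) = y / z.
Proof. by move=> x0; rewrite invfM mulrCA mulVKf. Qed.

Lemma deriv_homog d p :
  (homog d.+1 p)^`() =
  \sum_(a < d.+1) (a.+1%:R * p`_a.+1 - (d.+1 - a)%:R * p`_a) *: ('X^a * (1 - 'X) ^+ (d - a)).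
Proof.
pose m (i j : nat) : {poly rat} := 'X^i * (1 - 'X) ^+ j.
have D a j : (m a j)^`() = a%:R *: m a.-1 j - j%:R *: m a j.-1.
  rewrite /m derivM derivXn deriv_exp derivB derivX -polyC1 derivC sub0r mulN1r.
  by rewrite !scaler_nat mulNrn mulrN mulrnAl mulrnAr.
rewrite /homog (raddf_sum deriv) /= -/m.
under eq_bigr => a _ do rewrite derivZ D scalerBr !scalerA.
rewrite big_split /= big_ord_recl [X in X + _ + _](_ : _ = 0) ?add0r; last first.
  by rewrite mulr0 scale0r.
rewrite [X in _ + X]big_ord_recr [X in _ + (_ + X)](_ : _ = 0); last first.
  by rewrite /= subnn mulr0 scale0r oppr0.
rewrite addr0 -big_split /=.
apply: eq_bigr => a _; have ad := ltn_ord a.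
rewrite /bump /= add1n subSS (_ : (d.+1 - a).-1 = d - a)%N; last by lia.
by rewrite -scalerBl [p`_a.+1 * _]mulrC [p`_a * _]mulrC.
Qed.

(** The partial sums [S] telescope, so the derivatives agree; both sides vanish at [b%:R], where the
    range of integration is empty. *)
Lemma step_int_homog b d p : step_int b (homog d p) = homog d.+1 (homog_int b d p).
Proof.
apply: (@deriv_inj0 _ _ b%:R); last first.
  case: b; rewrite ?homog_at1 ?homog_at0 coef_poly /= ?ltnSn ?step_int1 ?step_int0.
    by rewrite big1 ?mul0r // => a; rewrite /rank_cond leqNgt ltn_ord.
  by rewrite big1 ?mul0r.
have -> : (step_int b (homog d p))^`() = (-1) ^+ b *: homog d p.
  by rewrite deriv_step_int; case: b; rewrite ?mulN1r ?scaleN1r ?mul1r ?scale1r.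
rewrite deriv_homog /homog scaler_sumr; apply: eq_bigr => a _; have ad := ltn_ord a.
rewrite scalerA; congr (_ *: _).
pose c (x : nat) : rat := (x`! * (d - x)`!)%:R * p`_x.
pose S i := \sum_(x < d.+1 | rank_cond b i x) c x.
have QE i : (i <= d.+1)%N -> (homog_int b d p)`_i = S i / (i`! * (d.+1 - i)`!)%:R.
  by rewrite /S /c coef_poly ltnS => ->.
have SE : S a.+1 - S a = (-1) ^+ b * c a.
  clear QE; rewrite {}/S /rank_cond; case: b.
    rewrite (bigD1 (P := fun x : 'I__ => (a <= x)%N) a) //= opprD addrCA.
    rewrite [X in _ + (_ - X)](eq_bigl (fun x : 'I_d.+1 => (a < x)%N))
      ?subrr ?addr0 ?mulN1r // => x.
    by rewrite ltn_neqAle andbC eq_sym.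
  rewrite (bigD1 (P := fun x : 'I__ => (x < a.+1)%N) a) //= -addrA.
  rewrite (eq_bigl (fun x : 'I_d.+1 => (x < a)%N)) ?subrr ?addr0 ?mul1r // => x.
  by rewrite ltnS andbC -ltn_neqAle.
have a1 : a.+1%:R * (S a.+1 / (a.+1`! * (d.+1 - a.+1)`!)%:R) = S a.+1 / (a`! * (d - a)`!)%:R.
  have -> : (a.+1`! * (d.+1 - a.+1)`! = a.+1 * (a`! * (d - a)`!))%N.
    by rewrite subSS factS mulnA.
  by rewrite natrM; apply: cancel_denom; rewrite pnatr_eq0.
have a2 : (d.+1 - a)%:R * (S a / (a`! * (d.+1 - a)`!)%:R) = S a / (a`! * (d - a)`!)%:R.
  have -> : (a`! * (d.+1 - a)`! = (d.+1 - a) * (a`! * (d - a)`!))%N.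
    have -> : (d.+1 - a = (d - a).+1)%N by lia.
    by rewrite factS mulnCA.
  by rewrite natrM; apply: cancel_denom; rewrite pnatr_eq0; lia.
have f0 := fact2_neq0 a (d - a).
rewrite !QE ?a1 ?a2; [|by lia|by lia].
rewrite -mulrBl SE /c; move: ((a`! * (d - a)`!)%:R : rat) f0 => f f0.
by rewrite [f * _]mulrC mulrA mulfK.
Qed.

Fixpoint tree_poly t : {poly rat} :=
  if t is Br b t1 t2 then homog_int b (edges t1) (tree_poly t1) * tree_poly t2 else 1.

Lemma size_tree_poly t : (size (tree_poly t) <= (edges t).+1)%N.
Proof.
elim: t => [|b t1 IH1 t2 IH2] /=; first by rewrite size_poly1.
apply: leq_trans (size_polyMleq _ _) _.
have h : (size (homog_int b (edges t1) (tree_poly t1)) <= (edges t1).+2)%N by exact: size_poly.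
by rewrite -subn1 leq_subLR; apply: leq_trans (leq_add h IH2) _; lia.
Qed.

Lemma tree_vol_homog t : tree_vol t = homog (edges t) (tree_poly t).
Proof.
elim: t => [|b t1 IH1 t2 IH2] /=.
  by rewrite -(expr0 'X) homogXn // subnn expr0 mulr1.
rewrite IH1 IH2 step_int_homog -addSn homogM ?size_tree_poly //.
exact: size_poly.
Qed.

(** * Ranks of labels in a finite set *)

Section Ranks.
Variable M : nat.
Implicit Types (A B : {set 'I_M}).

Definition below r A := [set z in A | (z < r)%N].

Lemma below_lt A (y : 'I_M) : y \in A -> (#|below y A| < #|A|)%N.
Proof.
move=> yA; apply: proper_card; apply/properP; split.
  by apply/subsetP => z; rewrite inE => /andP[].
by exists y; rewrite // inE yA ltnn.
Qed.

Lemma below_mono A (x y : 'I_M) : x \in A -> (x < y)%N -> (#|below x A| < #|below y A|)%N.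
Proof.
move=> xA xy; apply: proper_card; apply/properP; split.
  by apply/subsetP => z; rewrite !inE => /andP[-> /ltn_trans->].
by exists x; rewrite !inE ?xA ?xy // ltnn.
Qed.

Lemma rank_condP b r A (y : 'I_M) : y \in A -> (y : nat) != r ->
  step b r y = rank_cond b #|below r A| #|below y A|.
Proof.
have sub (i j : nat) : (i <= j)%N -> (#|below i A| <= #|below j A|)%N.
  move=> ij; apply: subset_leq_card; apply/subsetP => z.
  by rewrite !inE => /andP[-> /leq_trans->].
move=> yA yr; have lt : (y < r)%N -> (#|below y A| < #|below r A|)%N.
  move=> lt; apply: leq_trans (sub y.+1 r lt); apply: proper_card; apply/properP; split.
    by apply/subsetP => z; rewrite !inE => /andP[-> /ltnW].
  by exists y; rewrite !inE ?yA ?leqnn // ltnn.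
case: (ltngtP y r) yr => // yr _; rewrite /step /rank_cond.
  by rewrite ltnNge (ltnW yr) yr leqNgt (lt yr).
by rewrite yr ltnNge (ltnW yr) (sub _ _ (ltnW yr)) ltnNge (sub _ _ (ltnW yr)).
Qed.

(** The rank is a bijection from [A] onto the integers below [#|A|], and the direction of a step
    depends only on ranks. *)
Lemma sum_ranks b r A (f : nat -> rat) :
  (forall y : 'I_M, y \in A -> (y : nat) != r) ->
  \sum_(y in A | step b r y) f #|below y A| =
  \sum_(a < #|A| | rank_cond b #|below r A| a) f a.
Proof.
move=> rA; pose rk (y : 'I_M) := #|below y A|.
have perm_rk : perm_eq [seq rk y | y <- enum A] (iota 0 #|A|).
  have u : uniq [seq rk y | y <- enum A].
    rewrite map_inj_in_uniq ?enum_uniq // => x y; rewrite !mem_enum => xA yA e.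
    case: (ltngtP x y) => [/(below_mono xA)|/(below_mono yA)|/val_inj //];
      by rewrite -!/(rk _) e ltnn.
  have sub : {subset [seq rk y | y <- enum A] <= iota 0 #|A|}.
    by move=> z /mapP[y + ->]; rewrite mem_enum mem_iota => yA; rewrite below_lt.
  have [|_ e] := uniq_min_size u sub; first by rewrite size_map size_iota -cardE.
  by apply: uniq_perm; rewrite ?iota_uniq.
rewrite -(big_mkord (rank_cond b #|below r A|) f) /index_iota subn0.
rewrite -(perm_big _ perm_rk) big_map big_enum_cond /=.
by apply: eq_bigl => y; case: (boolP (y \in A)) => //= yA; rewrite (rank_condP b yA) ?rA.
Qed.

Lemma sum_subset_card A (f : nat -> rat) :
  \sum_(B : {set 'I_M} | B \subset A) f #|B| =
  \sum_(i < #|A|.+1) 'C(#|A|, i)%:R * f i.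
Proof.
pose h B : 'I_(#|A|.+1) := inord #|B|.
rewrite (partition_big h xpredT) //=; apply: eq_bigr => i _.
have e B : (B \subset A) && (h B == i) =
    (B \in [set B : {set 'I_M} | (B \subset A) && (#|B| == i)]).
  rewrite inE; case: (boolP (B \subset A)) => //= BA.
  by rewrite -val_eqE /= inordK // ltnS subset_leq_card.
under eq_bigl do rewrite e.
rewrite (eq_bigr (fun=> f i)) => [|B]; last by rewrite inE => /andP[_ /eqP->].
by rewrite sumr_const cards_draws mulr_natl.
Qed.

Lemma sum_subset_card2 (L U : {set 'I_M}) (f : nat -> nat -> rat) : [disjoint L & U] ->
  \sum_(B : {set 'I_M} | B \subset L :|: U) f #|B :&: L| #|B :&: U| =
  \sum_(i < #|L|.+1) \sum_(j < #|U|.+1) 'C(#|L|, i)%:R * ('C(#|U|, j)%:R * f i j).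
Proof.
move=> LU; have LU0 : L :&: U = set0 by apply/eqP; rewrite setI_eq0.
transitivity (\sum_(B1 : {set 'I_M} | B1 \subset L)
    \sum_(B2 : {set 'I_M} | B2 \subset U) f #|B1| #|B2|); last first.
  rewrite (sum_subset_card _ (fun i => \sum_(B2 : {set 'I_M} | B2 \subset U) f i #|B2|)).
  by apply: eq_bigr => i _; rewrite sum_subset_card mulr_sumr.
rewrite pair_big /= (reindex_onto (fun p => p.1 :|: p.2) (fun B => (B :&: L, B :&: U))) /=.
  apply: eq_big => [[B1 B2]|[B1 B2] /=]; rewrite /= xpair_eqE.
    apply/andP/andP => [[_ /andP[/eqP <- /eqP <-]]|[B1L B2U]]; first by rewrite !subsetIr.
    rewrite setUSS //; split=> //; rewrite !setIUl (setIidPl B1L) (setIidPl B2U).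
    have /eqP-> : B2 :&: L == set0 by rewrite -subset0 -LU0 setIC setIS.
    have /eqP-> : B1 :&: U == set0 by rewrite -subset0 -LU0 setSI.
    by rewrite setU0 set0U !eqxx.
  by move=> /andP[_ /andP[/eqP-> /eqP->]].
by move=> B BLU; rewrite -setIUr (setIidPl BLU).
Qed.

End Ranks.

Lemma coef_homog_int b d p i : (i <= d.+1)%N ->
  (i`! * (d.+1 - i)`!)%:R * (homog_int b d p)`_i =
  \sum_(a < d.+1 | rank_cond b i a) (a`! * (d - a)`!)%:R * p`_a.
Proof.
move=> id; rewrite coef_poly ltnS id; have := fact2_neq0 i (d.+1 - i).
by move: (_%:R) => x x0; rewrite mulrC divfK.
Qed.

(** The count depends on [r] and [A] only through the rank of [r]. In the induction, the binomial
    coefficients choosing which labels below and above the root go to the first branch absorb the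
    factorials, and a convolution of coefficients remains. *)
Lemma nb_labelings_coef M t r (A : {set 'I_M}) :
  (forall y : 'I_M, y \in A -> (y : nat) != r) -> #|A| = edges t ->
  nb_labelings t r A =
  (#|below r A|`! * (edges t - #|below r A|)`!)%:R * (tree_poly t)`_#|below r A|.
Proof.
elim: t r A => [|b t1 IH1 t2 IH2] r A rA cA.
  have -> : A = set0 by apply/eqP; rewrite -cards_eq0 cA.
  have -> : below r set0 = set0 :> {set 'I_M} by apply/setP => z; rewrite !inE.
  rewrite cards0 coefC /= mulr1 /nb_labelings big_seq1 /=.
  have -> : label_set M [::] = set0 by apply/setP => z; rewrite !inE.
  by rewrite eqxx.
rewrite nb_labelings_Br.
set d := edges t1; set e := edges t2; set L := below r A; set a := #|L|.
pose Q := homog_int b d (tree_poly t1); pose P := tree_poly t2.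
have cA' : #|A| = (d + e).+1 := cA.
pose U := A :\: L; pose u := #|U|.
have LA : L \subset A by apply/subsetP => z; rewrite inE => /andP[].
have aE : (a + u = (d + e).+1)%N by rewrite -cA' -(cardsID L A) (setIidPr LA).
(* The first branch takes [i] labels below the root and [j] above, [d.+1] in all since its top
   vertex is included. *)
pose f i j : rat := if (i + j == d.+1)%N then
   (i`! * (d.+1 - i)`!)%:R * Q`_i * ((a - i)`! * (e - (a - i))`!)%:R * P`_(a - i) else 0.
have AE : A = L :|: U by rewrite -{1}(setID A L) (setIidPr LA).
have term (B : {set 'I_M}) : B \subset A ->
    (\sum_(y in B | step b r y) nb_labelings t1 y (B :\ y)) * nb_labelings t2 r (A :\: B) =
    f #|B :&: L| #|B :&: U|.
  move=> BA; have cB : (#|B :&: L| + #|B :&: U| = #|B|)%N.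
    by rewrite -(cardsID L B) /U setIDA (setIidPl BA).
  have rB (y : 'I_M) : y \in B -> (y : nat) != r by move=> yB; apply/rA/(subsetP BA).
  rewrite /f cB; case: eqP => [cBd|/eqP cBd]; last first.
    rewrite big1 ?mul0r // => y /andP[yB _]; apply: nb_labelings_card.
    by have := cardsD1 y B; rewrite yB -/d; lia.
  have inner : \sum_(y in B | step b r y) nb_labelings t1 y (B :\ y) =
      (#|B :&: L|`! * (d.+1 - #|B :&: L|)`!)%:R * Q`_#|B :&: L|.
    have belowB : below r B = B :&: L.
      by apply/setP => z; rewrite !inE; case: (boolP (z \in B)) => //= /(subsetP BA)->.
    rewrite /Q coef_homog_int; last by rewrite -cBd subset_leq_card ?subsetIl.
    rewrite -belowB -cBd.
    rewrite -(@sum_ranks M b r B (fun a => (a`! * (d - a)`!)%:R * (tree_poly t1)`_a)) //.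
    apply: eq_bigr => y /andP[yB _]; rewrite IH1.
    + suff -> : below y (B :\ y) = below y B by [].
      by apply/setP => z; rewrite !inE -val_eqE; case: ltngtP => //=; rewrite ?andbF.
    + by move=> z; rewrite !inE => /andP[].
    + by have := cardsD1 y B; rewrite yB -/d; lia.
  have outer : nb_labelings t2 r (A :\: B) =
      ((a - #|B :&: L|)`! * (e - (a - #|B :&: L|))`!)%:R * P`_(a - #|B :&: L|).
    have belowAB : #|below r (A :\: B)| = (a - #|B :&: L|)%N.
      rewrite -/(#|L| - _)%N setIC -cardsD; congr #|pred_of_set _|.
      by apply/setP => z; rewrite !inE andbA.
    rewrite IH2 ?belowAB // => [y|]; first by rewrite inE => /andP[_ /rA].
    by rewrite cardsD (setIidPr BA) cA' cBd -/e; lia.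
  by rewrite inner outer !mulrA.
rewrite (eq_bigr _ term) {1}AE sum_subset_card2; last first.
  rewrite -setI_eq0 /U; apply/eqP/setP => z.
  by rewrite in_setI in_setD in_set0; case: (z \in L).
rewrite /= -/Q -/P -/a -/u coefM mulr_sumr; apply: eq_bigr => i _; have ia := ltn_ord i.
have uE : ((edges (Br b t1 t2)) - a = u)%N by rewrite /= -/d -/e -aE addKn.
rewrite /= in uE; rewrite uE.
case: (leqP i d.+1) => id; last first.
  rewrite [Q`_i]nth_default ?mul0r ?mulr0; last by apply: leq_trans id; exact: size_poly.
  by rewrite big1 // => j _; rewrite /f; case: eqP => [|_]; [lia|rewrite !mulr0].
case: (leqP (d.+1 - i) u) => iu; last first.
  rewrite [P`__]nth_default ?mulr0; last first.
    by apply: leq_trans (size_tree_poly _) _; rewrite -/e; lia.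
  rewrite big1 // => j _; have := ltn_ord j; rewrite /f.
  by case: eqP => [|_ _]; [lia|rewrite !mulr0].
have iu' : (d.+1 - i < u.+1)%N by rewrite ltnS.
rewrite (bigD1 (Ordinal iu')) //= [X in _ + X]big1 ?addr0 => [|j]; last first.
  by rewrite -val_eqE /f /= => ji; case: eqP => [|_]; [lia|rewrite !mulr0].
rewrite /f (_ : (i + (d.+1 - i))%N == d.+1); last by apply/eqP; lia.
rewrite -(bin_fact (ia : (i <= a)%N)) -(bin_fact iu).
rewrite (_ : u - (d.+1 - i) = e - (a - i))%N; last by lia.
rewrite !natrM.
move: ('C(a, i)%:R : rat) ('C(u, d.+1 - i)%:R : rat) (i`!%:R : rat) ((a - i)`!%:R : rat).
move: ((d.+1 - i)`!%:R : rat) ((e - (a - i))`!%:R : rat) Q`_i P`_(a - i).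
by move=> x1 x2 x3 x4 x5 x6 x7 x8; ring.
Qed.

Lemma card_ord_lt n r : (r <= n)%N -> #|[set z : 'I_n | (z < r)%N]| = r.
Proof.
move=> rn; rewrite cardsE -sum1_card (big_ord_narrow rn) /=.
by rewrite sum_nat_const card_ord muln1.
Qed.

(** Integrating over the root label is an ascending step from label 0, that is, coefficient 0 of
    [homog_int true], where every rank is admissible. *)
Lemma sum_nb_labelings t :
  \sum_(r < (edges t).+1) nb_labelings t r [set~ r] =
  (edges t).+1`!%:R * unit_int (tree_vol t).
Proof.
have -> : unit_int (tree_vol t) = (step_int true (tree_vol t)).[0] by rewrite step_int0.
rewrite tree_vol_homog step_int_homog homog_at0.
have := @coef_homog_int true (edges t) (tree_poly t) 0 isT.
rewrite fact0 mul1n subn0 => ->; apply: eq_bigr => r _.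
rewrite nb_labelings_coef; last 2 first.
- by move=> y; rewrite !inE.
- by rewrite cardsC1 card_ord.
suff -> : #|below r [set~ r]| = r by [].
have -> : below r [set~ r] = [set z : 'I__ | (z < r)%N].
  by apply/setP => z; rewrite !inE -val_eqE; case: ltngtP.
exact: card_ord_lt (ltnW (ltn_ord r)).
Qed.

(** * Pairings of a signed tree *)

Fixpoint pairs t a : seq (nat * nat) :=
  if t is Br _ t1 t2 then
    (a, (a + (edges t1).*2).+1) :: pairs t1 a.+1 ++ pairs t2 (a + (edges t1).*2).+2
  else [::].

Lemma pairs_range t a (p : nat * nat) : p \in pairs t a ->
  [/\ a <= p.1, p.1 < p.2 & p.2 < a + (edges t).*2]%N.
Proof.
elim: t a => //= b t1 IH1 t2 IH2 a.
rewrite inE mem_cat => /or3P[/eqP -> /=|/IH1[]|/IH2[]]; split; lia.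
Qed.

Lemma pairs_cover t a (i : nat) : (a <= i < a + (edges t).*2)%N ->
  exists2 p : nat * nat, p \in pairs t a & (i == p.1) || (i == p.2).
Proof.
elim: t a => [|b t1 IH1 t2 IH2] a /= ai; first by exfalso; lia.
have [->|ia] := eqVneq i a; first by exists (a, (a + (edges t1).*2).+1); rewrite ?mem_head //= eqxx.
case: (ltngtP i (a + (edges t1).*2).+1) => h.
- case: (IH1 a.+1) => [|p pt1 ip]; first by lia.
  by exists p; rewrite // inE mem_cat pt1 orbT.
- case: (IH2 (a + (edges t1).*2).+2) => [|p pt2 ip]; first by lia.
  by exists p; rewrite // inE mem_cat pt2 !orbT.
by exists (a, (a + (edges t1).*2).+1); rewrite ?mem_head //= h eqxx orbT.
Qed.

Definition nested (p q : nat * nat) := (p.1 < q.1)%N && (q.2 < p.2)%N.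

Lemma pairs_laminar t a (p q : nat * nat) : p \in pairs t a -> q \in pairs t a ->
  [|| p == q, (p.2 < q.1)%N, (q.2 < p.1)%N, nested p q | nested q p].
Proof.
elim: t a => //= b t1 IH1 t2 IH2 a; rewrite /nested.
rewrite !inE !mem_cat => /or3P[/eqP->|p1|p2] /or3P[/eqP->|q1|q2];
  rewrite ?eqxx //=; try exact: IH1 p1 q1; try exact: IH2 p2 q2;
  apply/or4P; try have [? ? ?] := pairs_range p1; try have [? ? ?] := pairs_range p2;
  try have [? ? ?] := pairs_range q1; try have [? ? ?] := pairs_range q2.
- by constructor 4; apply/orP; left; lia.
- by constructor 2; lia.
- by constructor 4; apply/orP; right; lia.
- by constructor 2; lia.
- by constructor 3; lia.
- by constructor 3; lia.
Qed.

Lemma pairs_signs t a (p : nat * nat) : p \in pairs t a ->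
  nth false (word t) (p.2 - a) = ~~ nth false (word t) (p.1 - a).
Proof.
elim: t a => //= b t1 IH1 t2 IH2 a; rewrite inE mem_cat.
have s1 := size_word t1.
case/or3P => [/eqP->|/[dup] /pairs_range[h1 h2 h3] /IH1 e|/[dup] /pairs_range[h1 h2 h3] /IH2 e] /=.
- rewrite subnn (_ : (a + _).+1 - a = (size (word t1)).+1)%N /=; last by lia.
  by rewrite nth_cat ltnn subnn.
- have x1 : (p.1 - a = (p.1 - a.+1).+1)%N by lia.
  have x2 : (p.2 - a = (p.2 - a.+1).+1)%N by lia.
  have l1 : (p.1 - a.+1 < (edges t1).*2)%N by lia.
  have l2 : (p.2 - a.+1 < (edges t1).*2)%N by lia.
  by rewrite x1 x2 /= !nth_cat !s1 l1 l2.
rewrite (_ : p.2 - a = (size (word t1) + (p.2 - (a + (edges t1).*2).+2).+1).+1)%N; last by lia.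
rewrite (_ : p.1 - a = (size (word t1) + (p.1 - (a + (edges t1).*2).+2).+1).+1)%N; last by lia.
by rewrite /= !nth_cat !ltnNge !leq_addr /= !addKn /= e.
Qed.

(** The partner of [a] under [R] fixes the size of the first branch; then both branches are compared
    recursively. *)
Lemma pairs_inj (R : rel nat) t t' a :
  (forall i j j', R i j -> R i j' -> j = j') ->
  (forall p : nat * nat, p \in pairs t a -> R p.1 p.2) ->
  (forall p : nat * nat, p \in pairs t' a -> R p.1 p.2) ->
  word t = word t' -> t = t'.
Proof.
move=> Rfun; elim: t t' a => [|b t1 IH1 t2 IH2] [|b' t1' t2'] a //= H H' [-> w12].
have e1 : edges t1 = edges t1'.
  have := Rfun _ _ _ (H _ (mem_head _ _)) (H' _ (mem_head _ _)) => /= e; lia.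
have /eqP := w12; rewrite eqseq_cat ?size_word ?e1 // => /andP[/eqP w1 /eqP[w2]].
congr Br.
  by apply: (IH1 _ a.+1) => // p pt; [apply: H|apply: H']; rewrite inE mem_cat pt orbT.
apply: (IH2 _ (a + (edges t1).*2).+2) => // p pt; [apply: H|apply: H'];
  by rewrite inE mem_cat -?e1 pt !orbT.
Qed.

(** * Walking around a signed tree *)

(* The vertices met after the first one, [r], when walking around [t], the
   vertices other than [r] being numbered in preorder from [c] on. *)
Fixpoint contour t r c : seq nat :=
  if t is Br _ t1 t2 then
    c :: contour t1 c c.+1 ++ r :: contour t2 r (c + edges t1).+1
  else [::].

Lemma size_contour t r c : size (contour t r c) = (edges t).*2.
Proof. by elim: t r c => //= b t1 IH1 t2 IH2 r c; rewrite size_cat /= IH1 IH2; lia. Qed.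

Lemma last_contour t r c : last r (contour t r c) = r.
Proof.
by elim: t r c => //= b t1 IH1 t2 IH2 r c; rewrite last_cat /= IH2.
Qed.

Lemma mem_contour t r c x :
  (x \in r :: contour t r c) = (x == r) || (c <= x < c + edges t)%N.
Proof.
elim: t r c => [|b t1 IH1 t2 IH2] r c /=.
  by rewrite mem_seq1; case: eqP => //= _; lia.
have -> : x \in [:: r, c & contour t1 c c.+1 ++ r :: contour t2 r (c + edges t1).+1] =
    (x \in c :: contour t1 c c.+1) || (x \in r :: contour t2 r (c + edges t1).+1).
  by rewrite !inE mem_cat !inE; case: (x == r); case: (x == c); rewrite ?orbT.
rewrite IH1 IH2; case: eqP => [->|] /=; case: eqP => [->|] /=; rewrite ?orbT //; lia.
Qed.

Lemma nth_contour_end t r c : nth 0%N (r :: contour t r c) (edges t).*2 = r.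
Proof. by rewrite -(size_contour t r c) nth_last /= last_contour. Qed.

Lemma contour_Br b t1 t2 r c i : let v := nth 0%N (r :: contour (Br b t1 t2) r c) in
  [/\ v 0%N = r,
      (i <= (edges t1).*2)%N -> v i.+1 = nth 0%N (c :: contour t1 c c.+1) i
    & v ((edges t1).*2 + i).+2 = nth 0%N (r :: contour t2 r (c + edges t1).+1) i].
Proof.
move=> v; have vS j : v j.+1 = nth 0%N
    ((c :: contour t1 c c.+1) ++ r :: contour t2 r (c + edges t1).+1) j by [].
split=> // [i1|]; rewrite vS nth_cat [size _]/= size_contour ltnS ?i1 //.
by rewrite ltnNge leq_addr subSS addKn.
Qed.

Lemma pairs_contour t r c a (p : nat * nat) : p \in pairs t a ->
  let v := nth 0%N (r :: contour t r c) in
  v (p.1 - a)%N = v (p.2.+1 - a)%N /\ v (p.1.+1 - a)%N = v (p.2 - a)%N.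
Proof.
elim: t r c a => // b t1 IH1 t2 IH2 r c a pt v.
have [v0 _ _] := contour_Br b t1 t2 r c 0.
have v1 i := let: And3 _ h _ := contour_Br b t1 t2 r c i in h.
have v2 i := let: And3 _ _ h := contour_Br b t1 t2 r c i in h.
rewrite -/v in v0 v1 v2; move: pt; rewrite /= inE mem_cat.
case/or3P => [/eqP->|pt|pt] /=.
- rewrite subnn v0 subSnn (v1 0%N) //.
  rewrite (_ : _.+2 - a = ((edges t1).*2 + 0).+2)%N ?v2; last by lia.
  by rewrite (_ : (a + _).+1 - a = (edges t1).*2.+1)%N ?v1 ?nth_contour_end //; lia.
- have [h1 h2 h3] := pairs_range pt; have [e1 e2] := IH1 c c.+1 _ pt.
  have sh (x : nat) : (a < x)%N -> (x - a = (x - a.+1).+1)%N by lia.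
  by rewrite !sh ?v1 ?e1 ?e2 //; lia.
have [h1 h2 h3] := pairs_range pt; have [e1 e2] := IH2 r (c + edges t1).+1 _ pt.
have sh (x : nat) : ((a + (edges t1).*2).+2 <= x)%N ->
    (x - a = ((edges t1).*2 + (x - (a + (edges t1).*2).+2)).+2)%N by lia.
by rewrite !sh ?v2 ?e1 ?e2 //; lia.
Qed.

(** A converse to [pairs_contour]: any equivalence containing the gluings relates all times at which
    the walk visits the same vertex. *)
Lemma contour_connect (E : rel nat) t r c a :
  (forall i, E i i) -> (forall i j, E i j -> E j i) ->
  (forall i j h, E i j -> E j h -> E i h) ->
  (forall p : nat * nat, p \in pairs t a -> E p.1 p.2.+1 /\ E p.1.+1 p.2) ->
  (r < c)%N ->
  let v := nth 0%N (r :: contour t r c) in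
  forall i j, (i <= (edges t).*2)%N -> (j <= (edges t).*2)%N -> v i = v j -> E (a + i)%N (a + j)%N.
Proof.
move=> E1 Es Et; elim: t r c a => [|b t1 IH1 t2 IH2] r c a EP rc v i j.
  by rewrite /= !leqn0 => /eqP-> /eqP->.
have [v0 _ _] := contour_Br b t1 t2 r c 0.
have v1 i := let: And3 _ h _ := contour_Br b t1 t2 r c i in h.
have v2 i := let: And3 _ _ h := contour_Br b t1 t2 r c i in h.
rewrite -/v in v0 v1 v2.
have [|Eroot _] := EP (a, (a + (edges t1).*2).+1); first exact: mem_head.
have {}IH1 : forall i j, (i <= (edges t1).*2)%N -> (j <= (edges t1).*2)%N ->
    v i.+1 = v j.+1 -> E (a + i.+1)%N (a + j.+1)%N.
  move=> x y hx hy; rewrite !v1 // !addnS -!addSn; apply: (IH1 c c.+1 a.+1) => // p pt.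
  by apply: EP; rewrite inE mem_cat pt orbT.
have {}IH2 : forall i j, (i <= (edges t2).*2)%N -> (j <= (edges t2).*2)%N ->
    v ((edges t1).*2 + i).+2 = v ((edges t1).*2 + j).+2 ->
    E (a + ((edges t1).*2 + i).+2)%N (a + ((edges t1).*2 + j).+2)%N.
  move=> x y hx hy; rewrite !v2 => e.
  have := IH2 r (c + edges t1).+1 (a + (edges t1).*2).+2 _ _ x y hx hy e.
  rewrite !addnS !addnA !addSn; apply=> [p pt|]; last by lia.
  by apply: EP; rewrite inE mem_cat pt !orbT.
(* The times split into the start, the walk around [t1], and the walk around [t2], which begins back
   at [r]. The preorder numbers met in the last two are disjoint. *)
have cut x : (x <= (edges (Br b t1 t2)).*2)%N ->
    [\/ x = 0%N, exists2 y, (y <= (edges t1).*2)%N & x = y.+1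
      | exists2 y, (y <= (edges t2).*2)%N & x = ((edges t1).*2 + y).+2].
  move=> /= hx; case: x hx => [|x] hx; first by constructor 1.
  case: (leqP x (edges t1).*2) => h; first by constructor 2; exists x.
  by constructor 3; exists (x - (edges t1).*2.+1)%N; lia.
have in1 y : (y <= (edges t1).*2)%N -> (c <= v y.+1 < c + (edges t1).+1)%N.
  move=> hy; rewrite v1 //.
  have : nth 0%N (c :: contour t1 c c.+1) y \in c :: contour t1 c c.+1.
    by rewrite mem_nth //= size_contour.
  by rewrite mem_contour; case: eqP => [->|_] /=; lia.
have in2 y : (y <= (edges t2).*2)%N ->
    (v ((edges t1).*2 + y).+2 == r) || (c + edges t1 < v ((edges t1).*2 + y).+2)%N.
  move=> hy; rewrite v2.
  have : nth 0%N (r :: contour t2 r (c + edges t1).+1) y \in r :: contour t2 r (c + edges t1).+1.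
    by rewrite mem_nth //= size_contour.
  by rewrite mem_contour; case: eqP => //= _; lia.
have to2 : E (a + 0)%N (a + ((edges t1).*2 + 0).+2)%N.
  by rewrite !addn0 !addnS.
have v20 : v ((edges t1).*2 + 0).+2 = r by rewrite v2.
move=> /cut[->|[x hx ->]|[x hx ->]] /cut[->|[y hy ->]|[y hy ->]] e.
- exact: E1.
- by exfalso; move: (in1 y hy); rewrite -e v0; lia.
- by apply: Et to2 _; apply: IH2 => //; rewrite v20 -e v0.
- by exfalso; move: (in1 x hx); rewrite e v0; lia.
- exact: IH1.
- by exfalso; move: (in1 x hx) (in2 y hy); rewrite e; lia.
- by apply/Es; apply: Et to2 _; apply: IH2 => //; rewrite v20 e v0.
- by exfalso; move: (in1 y hy) (in2 x hx); rewrite e; lia.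
- exact: IH2.
Qed.

Fixpoint walk (x : nat) (vs : seq nat) w : bool :=
  match vs, w with
  | y :: vs', b :: w' => step b x y && walk y vs' w'
  | _, _ => true
  end.

Lemma walk_cat x vs1 vs2 w1 w2 : size vs1 = size w1 ->
  walk x (vs1 ++ vs2) (w1 ++ w2) = walk x vs1 w1 && walk (last x vs1) vs2 w2.
Proof. by elim: vs1 w1 x => [|y vs IH] [|b w] //= x [/IH->]; rewrite andbA. Qed.

Lemma walkP x vs w : size vs = size w ->
  reflect (forall i, (i < size w)%N ->
             step (nth false w i) (nth 0%N (x :: vs) i) (nth 0%N (x :: vs) i.+1))
          (walk x vs w).
Proof.
elim: vs w x => [|y vs IH] [|b w] //= x; first by move=> _; apply: ReflectT.
case=> sw; apply: (iffP andP) => [[s /IH h] [|i] hi //|h]; first exact: h.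
by split; [exact: (h 0%N)|apply/IH => // i hi; exact: (h i.+1)].
Qed.

(** Each edge is walked once away from the root and once back; the return carries the opposite
    letter and imposes the same inequality. *)
Lemma labels_ok_walk (g : nat -> nat) t r c :
  labels_ok t (g r) (map g (iota c (edges t))) = walk (g r) (map g (contour t r c)) (word t).
Proof.
elim: t r c => //= b t1 IH1 t2 IH2 r c.
rewrite map_cat walk_cat /=; last by rewrite size_map size_contour size_word.
rewrite last_map last_contour -IH1 -IH2 iotaD map_cat addSn.
rewrite take_size_cat ?drop_size_cat ?size_map ?size_iota //.
rewrite /step; case: b => /=; by case: (_ < _)%N; rewrite ?andbF.
Qed.

(** * Total orders as permutations *)

Section Orders.
Variables (T : finType) (N : nat) (C : 'I_N -> T).
Hypothesis injC : injective C.
Implicit Types (s : {perm 'I_N}) (lt : {set T * T}).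

Definition order_of s : {set T * T} :=
  [set p | [exists i, exists j, (p == (C i, C j)) && (s i < s j)%N]].

Lemma mem_order_of s i j : ((C i, C j) \in order_of s) = (s i < s j)%N.
Proof.
rewrite inE; apply/existsP/idP => [[i' /existsP[j' /andP[/eqP[/injC-> /injC->]]]] //|ij].
by exists i; apply/existsP; exists j; rewrite eqxx.
Qed.

Lemma order_of_total s : strict_total_order (C @: [set: 'I_N]) (order_of s).
Proof.
have CE x : x \in C @: [set: 'I_N] -> exists i, x = C i by case/imsetP => i _ ->; exists i.
apply/and4P; split.
- apply/subsetP => p; rewrite inE => /existsP[i /existsP[j /andP[/eqP-> _]]].
  by rewrite in_setX !imset_f.
- by apply/forall_inP => _ /CE[i ->]; rewrite mem_order_of ltnn.
- apply/forall_inP => _ /CE[i ->]; apply/forall_inP => _ /CE[j ->].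
  apply/forall_inP => _ /CE[h ->]; rewrite !mem_order_of.
  by apply/implyP => ij; apply/implyP; exact: ltn_trans.
- apply/forall_inP => _ /CE[i ->]; apply/forall_inP => _ /CE[j ->]; apply/implyP => ij.
  rewrite !mem_order_of -neq_ltn; apply: contraNneq ij => e.
  by rewrite (perm_inj (val_inj e)).
Qed.

Lemma order_of_inj : injective order_of.
Proof.
have rankE s i : (s i : nat) = #|[set j | (C j, C i) \in order_of s]|.
  rewrite -[LHS](card_ord_lt (ltnW (ltn_ord (s i)))) -(card_preimset _ (@perm_inj _ s)).
  by apply: eq_card => j; rewrite [RHS]in_set mem_order_of !inE.
by move=> s s' e; apply/permP => i; apply: ord_inj; rewrite !rankE e.
Qed.

Lemma order_of_surj lt :
  strict_total_order (C @: [set: 'I_N]) lt -> exists s, lt = order_of s.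
Proof.
case/and4P => /subsetP sub /forall_inP irr /forall_inP tr /forall_inP tot.
have CV i : C i \in C @: [set: 'I_N] by exact: imset_f.
have ltT i j h : (C i, C j) \in lt -> (C j, C h) \in lt -> (C i, C h) \in lt.
  have /forall_inP/(_ _ (CV j))/forall_inP/(_ _ (CV h)) := tr _ (CV i).
  by move=> /implyP H /H /implyP.
have ltI i : (C i, C i) \notin lt by exact: irr.
(* The rank [#|D i|] increases strictly along [lt], so ranks define the required permutation. *)
pose D i := [set j | (C j, C i) \in lt].
have Dlt i : (#|D i| < N)%N.
  rewrite -[X in (_ < X)%N]card_ord -cardsT; apply: proper_card.
  by apply/properP; split; [exact: subsetT|exists i; rewrite !inE].
have Dmono i j : (C i, C j) \in lt -> (#|D i| < #|D j|)%N.
  move=> ij; apply: proper_card; apply/properP; split.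
    by apply/subsetP => h; rewrite !inE => /ltT; apply.
  by exists i; rewrite !inE.
have total i j : i != j -> ((C i, C j) \in lt) || ((C j, C i) \in lt).
  move=> ij; have /forall_inP/(_ _ (CV j))/implyP := tot _ (CV i); apply.
  by rewrite (inj_eq injC).
pose r i := Ordinal (Dlt i).
have r_inj : injective r.
  move=> i j /(congr1 val) /= e; apply/eqP; apply/negP => /negP/total/orP[]/Dmono;
  by rewrite e ltnn.
exists (perm r_inj); apply/setP => -[x y].
case: (boolP ((x, y) \in setX (C @: [set: 'I_N]) (C @: [set: 'I_N]))).
  rewrite in_setX => /andP[/imsetP[i _ ->] /imsetP[j _ ->]].
  rewrite mem_order_of !permE /=; apply/idP/idP => [/Dmono //|].
  by case: (eqVneq i j) => [->|/total/orP[//|/Dmono/ltnW]]; rewrite ?ltnn // leqNgt => /negPf->.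
move=> nV; rewrite (contraNF (sub _) nV); apply/esym; apply: contraNF nV.
by have /and4P[/subsetP/(_ (x, y))] := order_of_total (perm r_inj).
Qed.

Lemma card_orders (P : pred {set T * T}) :
  #|[set lt | strict_total_order (C @: [set: 'I_N]) lt && P lt]| =
  #|[set s | P (order_of s)]|.
Proof.
rewrite -(card_imset _ order_of_inj); apply: eq_card => lt; rewrite inE.
apply/andP/imsetP => [[/order_of_surj[s ->] Ps]|[s Ps ->]]; first by exists s; rewrite ?inE.
by rewrite inE in Ps; rewrite order_of_total.
Qed.

End Orders.

Lemma card_perm_labelings t :
  #|[set s : {perm 'I_(edges t).+1} |
      labels_ok t (s ord0) [seq (s (inord n) : nat) | n <- iota 1 (edges t)]]|%:R =
  \sum_(r < (edges t).+1) nb_labelings t r [set~ r].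
Proof.
set N := (edges t).+1.
pose L (s : {perm 'I_N}) := [seq (s (inord n) : nat) | n <- iota 0 N].
pose ok l := if l is r :: l' then labels_ok t r l' else false.
have LE s : L s = (s ord0 : nat) :: [seq (s (inord n) : nat) | n <- iota 1 (edges t)].
  rewrite /L /N /=; congr ((s _ : nat) :: _); apply: val_inj; exact: inordK.
have L_inj : injective L.
  move=> s s' e; apply/permP => i; apply: val_inj.
  have := congr1 (fun l => nth 0%N l i) e; rewrite !(nth_map 0%N) ?size_iota ?ltn_ord //.
  by rewrite nth_iota ?ltn_ord // add0n inord_val.
(* Listing the values of a permutation, root label first, gives each sequence of [N] distinct labels
   exactly once. *)
have perm_L : perm_eq [seq L s | s <- index_enum {perm 'I_N}] [seq l <- nat_seqs N N | uniq l].
  apply: uniq_perm; rewrite ?map_inj_uniq ?index_enum_uniq ?filter_uniq ?nat_seqs_uniq //.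
  move=> l; rewrite mem_filter mem_nat_seqs; apply/mapP/and3P => [[s _ ->]|[ul /eqP sl lN]].
    split; rewrite ?size_map ?size_iota //; last by apply/allP => _ /mapP[n _ ->].
    rewrite map_inj_in_uniq ?iota_uniq // => i j.
    rewrite !mem_iota !add0n => /andP[_ iN] /andP[_ jN].
    by move=> /ord_inj/perm_inj/(congr1 (@nat_of_ord _)); rewrite !inordK.
  have f_lt (i : 'I_N) : (nth 0%N l i < N)%N by apply: (allP lN); rewrite mem_nth ?sl.
  pose f i := Ordinal (f_lt i).
  have f_inj : injective f.
    move=> i j /(congr1 val) /= /eqP; rewrite nth_uniq ?sl // => /eqP; exact: val_inj.
  exists (perm f_inj); first by rewrite mem_index_enum.
  apply: (@eq_from_nth _ 0%N); rewrite ?size_map ?size_iota // => i; rewrite sl => iN.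
  by rewrite (nth_map 0%N) ?size_iota // nth_iota // add0n permE /= inordK.
transitivity (\sum_(l <- [seq L s | s <- index_enum {perm 'I_N}]) (ok l)%:R : rat).
  rewrite big_map -sum1_card natr_sum big_mkcond.
  by apply: eq_bigr => s _; rewrite inE LE /=; case: ifP.
rewrite (perm_big _ perm_L) big_filter big_mkcond.
rewrite -[nat_seqs N N]/(nat_seqs N (edges t).+1) big_nat_seqs /=.
apply: eq_bigr => r _; rewrite /nb_labelings; apply: eq_big_seq => l.
rewrite mem_nat_seqs => /andP[/eqP sl lN].
case: (boolP ((r : nat) \in l)) => /= rl.
  suff -> : (label_set N l == [set~ r]) = false by rewrite andbF.
  by apply/negP => /eqP/setP/(_ r); rewrite !inE rl eqxx.
case: (boolP (uniq l)) => //= ul.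
suff -> : label_set N l == [set~ r] by [].
rewrite eqEcard cardsC1 card_ord card_label_set // sl leqnn andbT.
apply/subsetP => x; rewrite !inE => xl; apply: contraNneq rl => <-; exact: xl.
Qed.

(** * Noncrossing pairings of the polygon *)

Section Polygon.
Variables (k : nat) (k0 : (0 < k)%N).
Implicit Types (sigma : {set {set 'I_k}}).

Definition pos (p : nat) : 'I_k := Ordinal (ltn_pmod p k0).

Lemma val_pos p : (p < k)%N -> pos p = p :> nat.
Proof. by move=> pk; rewrite /= modn_small. Qed.

Lemma pos_val (i : 'I_k) : pos i = i.
Proof. by apply: val_inj; rewrite /= modn_small. Qed.

Lemma ordS_pos p : ordS (pos p) = pos p.+1.
Proof. by apply: val_inj; rewrite /= -addn1 modnDml addn1. Qed.

Lemma set2_inj (a b c d : 'I_k) : [set a; b] = [set c; d] ->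
  (a = c /\ b = d) \/ (a = d /\ b = c).
Proof.
move=> e; have h1 : c \in [set a; b] by rewrite e set21.
have h2 : d \in [set a; b] by rewrite e set22.
have h3 : a \in [set c; d] by rewrite -e set21.
have h4 : b \in [set c; d] by rewrite -e set22.
move: h1 h2 h3 h4; rewrite !inE => /orP[] /eqP-> /orP[] /eqP-> h3 h4.
- by left; move: h4; rewrite orbb => /eqP->.
- by left.
- by right.
by left; move: h3; rewrite orbb => /eqP->.
Qed.

Lemma glue_sym sigma : symmetric (glue sigma).
Proof.
have sub x y : glue sigma x y -> glue sigma y x.
  case/existsP => i /existsP[j /andP[ij h]].
  apply/existsP; exists i; apply/existsP; exists j; rewrite ij.
  by case/orP: h => /andP[-> ->]; rewrite ?orbT.
by move=> x y; apply/idP/idP; exact: sub.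
Qed.

Lemma pairing_block sigma B : pairing sigma -> B \in sigma -> #|B| = 2%N.
Proof. by case/andP => _ /forall_inP H /H/eqP. Qed.

Lemma pairing_partner sigma i : pairing sigma ->
  exists2 j, i != j & [set i; j] \in sigma.
Proof.
move=> ps; have /andP[/and3P[/eqP cov _ _] _] := ps.
have : i \in cover sigma by rewrite cov inE.
case/bigcupP => B Bs iB; have /eqP/cards2P[x [y [xy BE]]] := pairing_block ps Bs.
move: iB; rewrite BE !inE => /orP[] /eqP->.
  by exists y; rewrite -?BE.
by exists x; rewrite 1?eq_sym // setUC -BE.
Qed.

Lemma pairing_meet sigma A B i : pairing sigma ->
  A \in sigma -> B \in sigma -> i \in A -> i \in B -> A = B.
Proof.
move=> /andP[/and3P[_ /trivIsetP dis _] _] As Bs iA iB; apply/eqP; apply/negPn/negP => ne.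
by have := dis _ _ As Bs ne; rewrite disjoint_subset => /subsetP/(_ _ iA); rewrite inE iB.
Qed.

Lemma pairing_fun sigma i j j' : pairing sigma ->
  [set i; j] \in sigma -> [set i; j'] \in sigma -> j = j'.
Proof.
move=> ps ij ij'; have /set2_inj := pairing_meet ps ij ij' (set21 _ _) (set21 _ _).
by case=> [[_ ->] //|[<- ->]].
Qed.

(** Transitivity of [lt] reduces directed paths to single arrows. *)
Lemma order_compatibleE (eps : 'I_k -> int) sigma lt :
  strict_total_order (qvertices sigma) lt ->
  order_compatible eps sigma lt =
  [forall i, (qvertex sigma (edge_target eps i), qvertex sigma (edge_source eps i)) \in lt].
Proof.
move=> /and4P[_ _ /forall_inP tr _].
have qV i : qvertex sigma i \in qvertices sigma by exact: imset_f.
apply/forall_inP/forallP => [H i|H _ /imsetP[i _ ->]].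
  have /forall_inP/(_ _ (qV (edge_source eps i)))/implyP := H _ (qV (edge_target eps i)); apply.
  apply/existsP; exists (qvertex sigma (edge_target eps i)); rewrite connect0 andbT.
  by apply/existsP; exists i; rewrite !eqxx.
apply/forall_inP => _ /imsetP[j _ ->]; apply/implyP.
case/existsP => z /andP[yz /connectP[p pz ->]].
have arrow x y : qarrow eps sigma x y ->
    [/\ x \in qvertices sigma, y \in qvertices sigma & (y, x) \in lt].
  by case/existsP => h /andP[/eqP-> /eqP->]; split.
have [yV zV zy] := arrow _ _ yz.
elim: p z {yz} zV zy pz => //= x p IH z zV zy /andP[zx px].
have [_ xV xz] := arrow _ _ zx; apply: IH => //.
by have /forall_inP/(_ _ zV)/forall_inP/(_ _ yV)/implyP/(_ xz)/implyP := tr _ xV; apply.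
Qed.

Definition tree_pairing t : {set {set 'I_k}} :=
  [set B in [seq [set pos p.1; pos p.2] | p <- pairs t 0]].

Section TreePairing.
Variables (t : tree) (tk : (edges t).*2 = k).
Let sigma := tree_pairing t.

Lemma tree_pairingP B :
  reflect (exists2 p : nat * nat, p \in pairs t 0 & B = [set pos p.1; pos p.2])
          (B \in sigma).
Proof. by rewrite inE; exact: mapP. Qed.

Lemma pairs_lt (p : nat * nat) : p \in pairs t 0 -> (p.1 < p.2)%N /\ (p.2 < k)%N.
Proof. by case/pairs_range => _ h1 h2; rewrite -tk. Qed.

Lemma mem_tree_pairing (i j : 'I_k) : [set i; j] \in sigma ->
  ((i : nat, j : nat) \in pairs t 0) \/ ((j : nat, i : nat) \in pairs t 0).
Proof.
case/tree_pairingP => -[a b] pt /=; have [/= ab bk] := pairs_lt pt.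
have ak := ltn_trans ab bk.
by case/set2_inj => -[-> ->]; rewrite !val_pos //; [left|right].
Qed.

Lemma tree_pairing_pairing : pairing sigma.
Proof.
have in2 (p : nat * nat) (x : 'I_k) : p \in pairs t 0 -> x \in [set pos p.1; pos p.2] ->
    (x = p.1 :> nat) \/ (x = p.2 :> nat).
  move=> /pairs_lt[h1 h2]; have h3 := ltn_trans h1 h2.
  by rewrite !inE => /orP[] /eqP->; rewrite val_pos //; [left|right].
apply/andP; split; last first.
  apply/forall_inP => B /tree_pairingP[p /pairs_lt[h1 h2] ->]; rewrite cards2.
  have h3 := ltn_trans h1 h2.
  by rewrite -val_eqE /= !modn_small // neq_ltn h1.
apply/and3P; split.
- apply/eqP/setP => i; rewrite !inE; apply/bigcupP.
  have [|p pt ip] := @pairs_cover t 0 i; first by rewrite add0n tk ltn_ord.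
  exists [set pos p.1; pos p.2]; first by apply/tree_pairingP; exists p.
  have [h1 h2] := pairs_lt pt; have h3 := ltn_trans h1 h2.
  by rewrite !inE -!val_eqE /= !modn_small.
- apply/trivIsetP => _ _ /tree_pairingP[p pt ->] /tree_pairingP[q qt ->] ne.
  rewrite -setI_eq0; apply/eqP/setP => x; rewrite in_setI in_set0; apply/negP => /andP[xp xq].
  have := pairs_laminar pt qt; rewrite /nested; have [h1 h2] := pairs_lt pt.
  have [h3 h4] := pairs_lt qt; case: eqP => [e|_] /=; first by rewrite e eqxx in ne.
  by case: (in2 _ _ pt xp) => e1; case: (in2 _ _ qt xq) => e2; lia.
apply/negP => /tree_pairingP[p _ /setP/(_ (pos p.1))].
by rewrite !inE eqxx.
Qed.

Lemma tree_pairing_noncrossing : noncrossing sigma.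
Proof.
apply/existsP => -[p /existsP[q /existsP[r /existsP[s /and5P[pq qr rs pr qs]]]]].
have pr' : (p : nat, r : nat) \in pairs t 0.
  by case: (mem_tree_pairing pr) => // /pairs_lt[/= h _]; exfalso; lia.
have qs' : (q : nat, s : nat) \in pairs t 0.
  by case: (mem_tree_pairing qs) => // /pairs_lt[/= h _]; exfalso; lia.
have := pairs_laminar pr' qs'; rewrite /nested xpair_eqE /=; lia.
Qed.

Lemma tree_pairing_compatible (eps : 'I_k -> int) :
  (forall i : 'I_k, eps i = if nth false (word t) i then 1 else -1) ->
  pairing_compatible eps sigma.
Proof.
move=> epsE; apply/forallP => i; apply/forallP => j; apply/implyP => /mem_tree_pairing.
by case=> /pairs_signs /=; rewrite !subn0 !epsE => ->; case: (nth _ _ _).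
Qed.

Definition label_of (p : nat) : nat := nth 0%N (0%N :: contour t 0 1) p.

Lemma label_of_lt p : (p <= k)%N -> (label_of p < (edges t).+1)%N.
Proof.
move=> pk; have : label_of p \in 0%N :: contour t 0 1.
  by rewrite mem_nth //= size_contour tk.
by rewrite mem_contour => /orP[/eqP->|] //; lia.
Qed.

Definition vertex_of (i : 'I_k) : 'I_(edges t).+1 := inord (label_of i).

Lemma val_vertex_of i : vertex_of i = label_of i :> nat.
Proof. by rewrite inordK // label_of_lt // ltnW. Qed.

(** The case [p = k] matters: the index wraps around to 0 while the walk returns to the root, so
    both sides are the root. *)
Lemma vertex_of_pos p : (p <= k)%N -> vertex_of (pos p) = label_of p :> nat.
Proof.
rewrite leq_eqVlt val_vertex_of => /orP[/eqP->|pk]; last by rewrite val_pos.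
have -> : (pos k : nat) = 0%N by rewrite /= modnn.
by rewrite -tk /label_of nth_contour_end.
Qed.

Lemma vertex_of_ordS (i : 'I_k) : vertex_of (ordS i) = label_of i.+1 :> nat.
Proof. by rewrite -{1}(pos_val i) ordS_pos vertex_of_pos. Qed.

Lemma vertex_of_surj n : exists i, vertex_of i = n.
Proof.
have : (n : nat) \in 0%N :: contour t 0 1.
  by rewrite mem_contour; have := ltn_ord n; case: (n : nat) => //= x; lia.
case/(nthP 0%N) => p; rewrite /= size_contour tk ltnS => pk e.
by exists (pos p); apply: ord_inj; rewrite vertex_of_pos.
Qed.

Lemma tree_pairing_glue (i j : 'I_k) : glue sigma i j -> vertex_of i = vertex_of j.
Proof.
have key (x y : 'I_k) : (x : nat, y : nat) \in pairs t 0 ->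
    vertex_of x = vertex_of (ordS y) /\ vertex_of (ordS x) = vertex_of y.
  move=> /(pairs_contour 0 1); rewrite /= !subn0 => -[e1 e2].
  by split; apply: ord_inj; rewrite ?vertex_of_ordS ?val_vertex_of.
case/existsP => x /existsP[y /andP[/mem_tree_pairing xy]].
by case/orP => /andP[/eqP-> /eqP->]; case: xy => /key[].
Qed.

(** Gluing never changes the visited tree vertex, so classes lie in fibres of [vertex_of];
    [contour_connect] shows that each fibre is a single class. *)
Lemma tree_pairing_qvertex i :
  qvertex sigma i = [set j | vertex_of j == vertex_of i].
Proof.
apply/setP => j; rewrite !inE; apply/connectP/eqP => [[p]|e].
  elim: p i => [|x p IH] i /=; first by move=> _ ->.
  by case/andP=> /tree_pairing_glue-> /IH.
apply/connectP.
pose E x y := connect (glue sigma) (pos x) (pos y).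
suff : E (0 + i)%N (0 + j)%N by rewrite /E !add0n !pos_val.
have symE := sym_connect_sym (glue_sym sigma).
apply: (@contour_connect E t 0 1 0).
- by move=> x; exact: connect0.
- by move=> x y; rewrite /E symE.
- by move=> x y z; exact: connect_trans.
- move=> p pt; have ps : [set pos p.1; pos p.2] \in sigma by apply/tree_pairingP; exists p.
  split; apply: connect1; apply/existsP.
    exists (pos p.1); apply/existsP; exists (pos p.2).
    by rewrite ps ordS_pos !eqxx.
  exists (pos p.2); apply/existsP; exists (pos p.1).
  by rewrite setUC ps ordS_pos !eqxx orbT.
- by [].
- by rewrite tk ltnW.
- by rewrite tk ltnW.
by move/(congr1 (@nat_of_ord _)): e; rewrite !val_vertex_of.
Qed.

Lemma card_tree_pairing_orders (eps : 'I_k -> int) :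
  (forall i : 'I_k, eps i = if nth false (word t) i then 1 else -1) ->
  #|[set lt | strict_total_order (qvertices sigma) lt && order_compatible eps sigma lt]| =
  #|[set s : {perm 'I_(edges t).+1} |
      labels_ok t (s ord0) [seq (s (inord n) : nat) | n <- iota 1 (edges t)]]|.
Proof.
move=> epsE; pose C n := [set j | vertex_of j == n].
have injC : injective C.
  move=> n n'; have [i <-] := vertex_of_surj n => /setP/(_ i).
  by rewrite !inE eqxx => /esym/eqP.
have qC i : qvertex sigma i = C (vertex_of i) by exact: tree_pairing_qvertex.
have VE : qvertices sigma = C @: [set: 'I_(edges t).+1].
  apply/setP => x; apply/imsetP/imsetP => [[i _ ->]|[n _ ->]].
    by exists (vertex_of i); rewrite ?qC.
  by have [i <-] := vertex_of_surj n; exists i; rewrite ?qC.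
pose P (lt : {set {set 'I_k} * {set 'I_k}}) :=
  [forall i, (C (vertex_of (edge_target eps i)), C (vertex_of (edge_source eps i))) \in lt].
transitivity #|[set lt | strict_total_order (C @: [set: 'I_(edges t).+1]) lt && P lt]|.
  apply: eq_card => lt; rewrite !inE -VE; case: (boolP (strict_total_order _ _)) => //= tot.
  by rewrite order_compatibleE //; apply: eq_forallb => i; rewrite !qC.
rewrite (card_orders injC); apply: eq_card => s; rewrite !inE.
pose g n : nat := s (inord n).
have -> : (s ord0 : nat) = g 0%N by rewrite /g; congr (s _ : nat); apply: ord_inj; rewrite inordK.
rewrite (labels_ok_walk g t 0 1).
have gE p : (p <= k)%N -> nth 0%N (g 0%N :: map g (contour t 0 1)) p = g (label_of p).
  by move=> pk; rewrite -map_cons (nth_map 0%N) //= size_contour tk.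
have stepE (i : 'I_k) : step (nth false (word t) i)
      (nth 0%N (g 0%N :: map g (contour t 0 1)) i) (nth 0%N (g 0%N :: map g (contour t 0 1)) i.+1) =
    ((C (vertex_of (edge_target eps i)), C (vertex_of (edge_source eps i))) \in order_of C s).
  rewrite (mem_order_of injC) !gE ?(ltnW (ltn_ord i)) ?ltn_ord //.
  rewrite /g -val_vertex_of -vertex_of_ordS !inord_val /edge_target /edge_source epsE.
  by case: (nth _ _ _).
have sw : size (map g (contour t 0 1)) = size (word t).
  by rewrite size_map size_contour size_word.
apply/forallP/(walkP _ sw) => [H i|H i]; last first.
  by rewrite -stepE; apply: H; rewrite size_word tk.
by rewrite size_word tk => ik; have := H (Ordinal ik); rewrite -stepE.
Qed.

End TreePairing.

(** The tree is built on intervals closed under taking partners: the partner [j] of the first point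
    splits off two smaller intervals, closed because [sigma] is noncrossing. *)
Lemma noncrossing_tree (eps : 'I_k -> int) sigma w :
  size w = k -> (forall i : 'I_k, eps i = if nth false w i then 1 else -1) ->
  pairing sigma -> noncrossing sigma -> pairing_compatible eps sigma ->
  exists2 t, word t = w & sigma = tree_pairing t.
Proof.
move=> sw epsE ps nc pc.
have cross (p q r s : 'I_k) : [set p; r] \in sigma -> [set q; s] \in sigma ->
    (p < q)%N -> (q < r)%N -> (r < s)%N -> False.
  move=> pr qs pq qr rs; move/negP: nc; apply; apply/existsP; exists p; apply/existsP; exists q.
  by apply/existsP; exists r; apply/existsP; exists s; rewrite pq qr rs pr qs.
pose closed a b := forall i j : 'I_k, [set i; j] \in sigma -> (a <= i < b)%N -> (a <= j < b)%N.
suff build n a b : (b - a <= n)%N -> (a <= b <= k)%N -> closed a b ->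
    exists t, [/\ word t = take (b - a) (drop a w), (edges t).*2 = (b - a)%N &
      forall p : nat * nat, p \in pairs t a -> [set pos p.1; pos p.2] \in sigma].
  have [||t [wt et pt]] := build k 0%N k (leq_subr _ _) _ _.
  - by rewrite leqnn.
  - by move=> i j _ _; rewrite /= ltn_ord.
  rewrite subn0 in et; exists t; first by rewrite wt subn0 drop0 -sw take_size.
  (* This inclusion suffices: a block of [sigma] meets some block of the tree pairing, itself in
     [sigma], and blocks that meet are equal. *)
  have ts B : B \in tree_pairing t -> B \in sigma.
    by case/(tree_pairingP t) => p /pt ? ->.
  apply/setP => B; apply/idP/idP; last exact: ts.
  move=> Bs; have : (0 < #|B|)%N by rewrite (pairing_block ps Bs).
  case/card_gt0P => i iB; have [j _ ij] := pairing_partner i (tree_pairing_pairing et).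
  by rewrite (pairing_meet ps Bs (ts _ ij) iB (set21 _ _)).
elim: n a b => [|n IH] a b bn /andP[ab bk] cl.
  by exists Leaf; split=> //; rewrite (_ : b - a = 0)%N ?take0 //; lia.
have [eab|nab] := eqVneq a b.
  by exists Leaf; split=> //; rewrite eab subnn ?take0.
have ak : (a < k)%N by lia.
have [j ij js] := pairing_partner (pos a) ps.
have va := val_pos ak.
have /andP[aj jb] : (a <= j < b)%N by apply: (cl _ _ js); rewrite va; lia.
have {}aj : (a < j)%N.
  by rewrite ltn_neqAle aj andbT; apply: contraNneq ij => e; apply/eqP/ord_inj; rewrite va e.
(* Partners inside the interval lie on the same side of [j], otherwise they would cross the block of
   [a] and [j]. *)
have other (x y : 'I_k) : [set x; y] \in sigma -> (a < x)%N -> x != j -> (a < x < b)%N ->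
    [/\ (a < y < b)%N, y != j & (x < j)%N = (y < j)%N].
  move=> xy ax xj /andP[_ xb].
  have /andP[ay yb] : (a <= y < b)%N by apply: (cl _ _ xy); rewrite (ltnW ax) xb.
  have yx : [set y; x] \in sigma by rewrite setUC.
  have ya : a != y.
    apply: contraNneq xj => e; apply/eqP; apply: (pairing_fun ps) js.
    by rewrite (_ : pos a = y) //; apply: ord_inj; rewrite va.
  have {ya}ay : (a < y)%N by rewrite ltn_neqAle ya.
  have yj : y != j.
    apply/eqP => e; have := pairing_fun ps (i := j) (j := x) (j' := pos a).
    rewrite -{1}e setUC xy setUC js => /(_ isT isT) e'.
    by rewrite e' va ltnn in ax.
  split; rewrite ?ay //; case: (ltngtP x j) => xj'; case: (ltngtP y j) => yj' //.
  - by case: (cross (pos a) x j y); rewrite ?va.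
  - by rewrite (ord_inj yj') eqxx in yj.
  - by case: (cross (pos a) y j x); rewrite ?va.
  - by rewrite (ord_inj xj') eqxx in xj.
have cl1 : closed a.+1 j.
  move=> x y xy xr; have xj : x != j by apply/eqP => e; move: xr; rewrite e; lia.
  have [||y1 y2 y3] := other x y xy _ xj; by lia.
have cl2 : closed j.+1 b.
  move=> x y xy xr; have xj : x != j by apply/eqP => e; move: xr; rewrite e; lia.
  have [||y1 y2 y3] := other x y xy _ xj; [by lia|by lia|].
  have {}y2 : (y : nat) != j by [].
  by lia.
have [||t1 [w1 e1 p1]] := IH a.+1 j _ _ cl1; [by lia|by have := ltn_ord j; lia|].
have [||t2 [w2 e2 p2]] := IH j.+1 b _ _ cl2; [by lia|by lia|].
have jE : (a + (edges t1).*2).+1 = j by lia.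
have sgn : nth false w j = ~~ nth false w a.
  have := implyP (forallP (forallP pc (pos a)) j) js.
  by rewrite !epsE va; case: (nth _ _ a); case: (nth _ _ j).
exists (Br (nth false w a) t1 t2); split=> /=.
- rewrite w1 w2 [drop a w](drop_nth false) ?sw // (_ : b - a = (b - a.+1).+1)%N /=; last by lia.
  congr (_ :: _); rewrite (_ : b - a.+1 = (j - a.+1) + (b - j.+1).+1)%N; last by lia.
  rewrite takeD drop_drop (_ : j - a.+1 + a.+1 = j)%N; last by lia.
  by rewrite [drop j w](drop_nth false) ?sw //= sgn.
- by lia.
move=> p; rewrite inE mem_cat => /or3P[/eqP->|/p1 //|].
  by rewrite /= jE (_ : pos j = j) ?pos_val.
by rewrite jE; exact: p2.
Qed.

End Polygon.

(** * Summing over pairings and the final count *)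

Lemma card_ordered_quotient_trees k (eps : 'I_k -> int) w :
  (0 < k)%N -> size w = k ->
  (forall i : 'I_k, eps i = if nth false w i then 1 else -1) ->
  #|ordered_quotient_trees eps|%:R = k./2.+1`!%:R * unit_int (vol w).
Proof.
move=> k0 sw epsE.
pose good sigma := [&& pairing sigma, noncrossing sigma & pairing_compatible eps sigma].
pose orders sigma := [set lt | strict_total_order (qvertices sigma) lt &&
  order_compatible eps sigma lt].
have -> : #|ordered_quotient_trees eps| = (\sum_(sigma | good sigma) #|orders sigma|)%N.
  rewrite -sum1_card (eq_bigl (fun u => good u.1 && (u.2 \in orders u.1))) => [|[s lt]].
    rewrite -(pair_big_dep good (fun s lt => lt \in orders s) (fun _ _ => 1%N)) /=.
    by apply: eq_bigr => s _; rewrite sum1_card.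
  by rewrite !inE /good /= -!andbA.
have treeP t : t \in trees w -> word t = w /\ (edges t).*2 = k.
  by rewrite mem_trees => /eqP tw; rewrite -size_word tw.
have perm_good : perm_eq [seq tree_pairing k0 t | t <- trees w]
    [seq sigma <- index_enum {set {set 'I_k}} | good sigma].
  apply: uniq_perm; rewrite ?filter_uniq ?index_enum_uniq //.
    rewrite map_inj_in_uniq ?trees_uniq // => t t' /treeP[tw tk] /treeP[tw' tk'] e.
    (* If two trees have the same pairing, this relation contains the pairs of both. The bound on
       [j] makes it functional on integers, as [pos] reduces modulo [k]. *)
    pose R (i j : nat) := ([set pos k0 i; pos k0 j] \in tree_pairing k0 t) && (j < k)%N.
    apply: (@pairs_inj R t t' 0); last by rewrite tw tw'.
    - move=> i j j' /andP[ij jk] /andP[ij' jk'].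
      have /(congr1 (@nat_of_ord _)) := pairing_fun (tree_pairing_pairing k0 tk) ij ij'.
      by rewrite !val_pos.
    - move=> p pt; rewrite /R; have [_ ->] := pairs_lt tk pt.
      by rewrite andbT; apply/tree_pairingP; exists p.
    - move=> p pt; rewrite /R e; have [_ ->] := pairs_lt tk' pt.
      by rewrite andbT; apply/tree_pairingP; exists p.
  move=> sigma; rewrite mem_filter mem_index_enum andbT.
  apply/mapP/and3P => [[t /treeP[tw tk] ->]|[ps nc pc]]; last first.
    have [t tw ->] := noncrossing_tree k0 sw epsE ps nc pc.
    by exists t; rewrite // mem_trees tw.
  split; [exact: tree_pairing_pairing|exact: tree_pairing_noncrossing|].
  by apply: tree_pairing_compatible => // i; rewrite tw.
rewrite natr_sum -big_filter -(perm_big _ perm_good) big_map /vol linear_sum mulr_sumr.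
apply: eq_big_seq => t /treeP[tw tk].
rewrite card_tree_pairing_orders // => [|i]; last by rewrite tw.
by rewrite card_perm_labelings sum_nb_labelings -tk doubleK.
Qed.

Lemma nth_block_word l m i : (i < 2 * m * l)%N ->
  nth false (block_word l m) i = ~~ odd (i %/ l).
Proof.
elim: m i => [|m IH] i; first by rewrite muln0.
move=> im; have l0 : (0 < l)%N by case: l im {IH} => //; rewrite muln0.
rewrite block_wordS !nth_cat !size_nseq !nth_nseq.
case: ltnP => [il|li]; first by rewrite divn_small.
have il : i = (l + (i - l))%N by rewrite subnKC.
case: ltnP => [il2|li2].
  by rewrite il -{1}(mul1n l) divnMDl // divn_small.
rewrite IH; last by lia.
have -> : (i %/ l = 2 + (i - l - l) %/ l)%N by rewrite -divnMDl //; congr (_ %/ l)%N; lia.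
by rewrite oddD.
Qed.

Lemma size_block_word l m : size (block_word l m) = (2 * m * l)%N.
Proof. by elim: m => [|m IH] //; rewrite block_wordS !size_cat !size_nseq IH; lia. Qed.

Theorem theorem1p2 (l m : nat) (hl : (1 <= l)%N) (hm : (1 <= m)%N) :
  #|ordered_quotient_trees (@block_signs l m)| = (m ^ (m * l))%N.
Proof.
have k0 : (0 < 2 * m * l)%N by rewrite !muln_gt0 hm hl.
have signs (i : 'I_(2 * m * l)) :
    block_signs i = if nth false (block_word l m) i then 1 else -1.
  by rewrite nth_block_word // /block_signs -signr_odd; case: odd.
(* Over the rationals, the number of labelings of the [m * l + 1] vertices cancels the denominator
   of the integral. *)
apply/eqP; rewrite -(eqr_nat rat).
rewrite (card_ordered_quotient_trees k0 (size_block_word l m) signs).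
rewrite unit_int_vol_block_word // -mulnA mul2n doubleK natrX mulrC divfK //.
exact: fact_neq0.
Qed.
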